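(* Let $\xi_1,\xi_2,\ldots$ be a positive recurrent Markov chain with transition kernel $p$ and invariant probability measure $\pi$ that is very weak reversible of order $1$. Assume that there exist $r\in(1,\infty]$ and a sequence $(A_n)_{n\in\mathbb{N}}$ in $\mathcal{F}$ with $0<\pi(A_n)\le\frac12$ and $\lim_{n\to\infty}k_2(A_n)=k_2$ such that $$\sup_{n\in\mathbb{N}}\|1_{A_n}f_{A_n}\|_{L^{r}(\pi_{A_n})}<\infty .$$ Then the chain has an $L^2(\pi)$-spectral gap if and only if $k_1>0$.
   Context: Setting: $\xi_1,\xi_2,\ldots$ is a time-homogeneous, discrete-time, positive recurrent Markov chain on an arbitrary measurable state space $(\Omega,\mathcal{F})$ with transition kernel $p(x,dy)$, $n$-step kernels $p^n(x,dy)$, and uniquely determined invariant probability measure $\pi$. The Markov operator is $Pf(x)=\int_\Omega f(y)\,p(x,dy)$ on $L^2(\pi)$. Let $L^2_{0,1}(\pi)=\{f\in L^2(\pi):\int f\,d\pi=0,\ \int f^2\,d\pi=1\}$. The chain (or $P$) has an $L^2(\pi)$-spectral gap if $\lim_{n\to\infty}\sup_{f\in L^2_{0,1}(\pi)}\|P^nf\|_2^{1/n}<1$. Let $Q$ be the measure on $\Omega^2$ with $Q(A\times B)=\int_A\pi(dx)\,p(x,B)$, and $\tilde Q(A\times B)=Q(B\times A)$, i.e. $\tilde Q(dx,dy)=\pi(dy)p(y,dx)$. It is assumed that $Q$ and $\tilde Q$ are equivalent (mutually absolutely continuous). The chain is very weak reversible of order $1$ if there exists $q\in(1,\infty]$ such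 that $\operatorname{ess\,sup}_{y\in\Omega}\left\|\frac{dQ}{d\tilde Q}(\cdot,y)\right\|_{L^q(p(y,\cdot))}<\infty$, the essential supremum being with respect to $\pi$. Isoperimetric constants: for $m\in\mathbb{N}$ and $A\in\mathcal{F}$ with $0<\pi(A)<1$, $k_m(A):=\frac{1}{\pi(A)\pi(A^c)}\int_A p^m(x,A^c)\,\pi(dx)$, and $k_m:=\inf_A k_m(A)$ over all such $A$. For $A\in\mathcal{F}$ with $\pi(A)>0$: $\pi_A(B):=\frac{\pi(A\cap B)}{\pi(A)}$ and $f_A(x):=\frac{p(x,A^c)}{p^2(x,A^c)}$, with the conventions $0/0=0$ and $a/0=\infty$ for $a>0$. *)

(* Defs.v *)
From HB Require Import structures.
From mathcomp Require Import all_boot all_order all_algebra.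
From mathcomp Require Import all_classical all_reals all_analysis.
(* Not re-exported by [all_analysis]. *)
From mathcomp Require Import measurable_realfun ess_sup_inf.

Set Implicit Arguments.
Unset Strict Implicit.
Unset Printing Implicit Defensive.

Import Order.TTheory GRing.Theory Num.Theory.
Import numFieldNormedType.Exports.

Local Open Scope classical_set_scope.
Local Open Scope ring_scope.
Local Open Scope ereal_scope.
Local Open Scope charge_scope.

Section iterated_kernel.
Context {d : measure_display} {T : measurableType d} {R : realType}.

(* p^0(x, .) is the Dirac mass at x and p^(n+1)(x, A) is the integral of
   p^n(y, A) against p(x, dy). *)
Fixpoint kernel_iter (p : R.-pker T ~> T) (n : nat) : R.-spker T ~> T :=
  if n is n'.+1 then mkcomp_noparam p (kernel_iter p n')
  else kdirac (@measurable_id _ T setT).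

End iterated_kernel.

Section markov_chain.
Context {d : measure_display} {T : measurableType d} {R : realType}.
Variables (p : R.-pker T ~> T) (pi : probability T R).

Definition invariant_prob (mu : probability T R) :=
  forall A, measurable A -> \int[mu]_x p x A = mu A.

(* Agreement is only required on measurable sets: the values of a measure on
   the other sets are irrelevant. *)
Definition uniquely_invariant :=
  invariant_prob pi /\
  forall mu : probability T R, invariant_prob mu ->
    forall A, measurable A -> mu A = pi A.

(* The expected number of visits to a set charged by the invariant probability
   is infinite from almost all of its points.  No irreducibility is required. *)
Definition positive_recurrent :=
  invariant_prob pi /\
  forall A, measurable A -> 0 < pi A ->
    {ae pi, forall x, A x -> \sum_(1 <= n <oo) kernel_iter p n x A = +oo}.

End markov_chain.

Section spectral_gap.
Context {d : measure_display} {T : measurableType d} {R : realType}.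
Variables (p : R.-pker T ~> T) (pi : probability T R).

(* For f in L^2(pi), f is p(x, .)-integrable for pi-almost every x; on the
   exceptional pi-null set the value is irrelevant. *)
Definition markov_op (f : T -> R) : T -> R :=
  fun x => (\int[p x]_y f y)%R.

Definition L2_01 : set (T -> R) :=
  [set f | [/\ f \in Lfun pi 2%:E, \int[pi]_x (f x)%:E = 0 &
               \int[pi]_x ((f x) ^+ 2)%:E = 1]].

Definition spectral_gap_seq (n : nat) : \bar R :=
  ereal_sup [set 'N[pi]_2%:E[EFin \o iter n markov_op f] `^ n%:R^-1
            | f in L2_01].

(* The existence of the limit is part of the definition, since [lim] is a total
   operator with a junk value on divergent sequences. *)
Definition L2_spectral_gap :=
  exists2 l : \bar R, spectral_gap_seq @ \oo --> l & l < 1.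

End spectral_gap.

Section edge_measure.
Context {d : measure_display} {T : measurableType d} {R : realType}.
Variables (p : R.-pker T ~> T) (pi : probability T R).

(* The measure pi(dx) p(x, dy); see [edge_measureX]. *)
Definition edge_measure (C : set (T * T)) : \bar R :=
  \int[pi]_x p x (xsection C x).

Let edge_measure0 : edge_measure set0 = 0.
Proof.
by apply: integral0_eq => x _; rewrite xsection0 measure0.
Qed.

Let edge_measure_ge0 C : 0 <= edge_measure C.
Proof. by apply: integral_ge0 => x _; exact: measure_ge0. Qed.

Let measurable_fun_edge (C : set (T * T)) : measurable C ->
  measurable_fun [set: T] (fun x => p x (xsection C x)).
Proof.
by move=> mC; apply: measurable_fun_xsection_finite_kernel; rewrite inE.
Qed.

Let edge_measure_sigma_additive : semi_sigma_additive edge_measure.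
Proof.
move=> F mF tF mUF.
have -> : edge_measure (\bigcup_n F n) =
    \sum_(0 <= n <oo) edge_measure (F n).
  rewrite -integral_nneseries//; last by move=> n; exact: measurable_fun_edge.
  apply: eq_integral => x _; rewrite xsection_bigcup.
  apply: measure_semi_bigcup => //.
  - by move=> n; exact: measurable_xsection.
  - exact: trivIset_xsection.
  - by apply: bigcup_measurable => n _; exact: measurable_xsection.
by apply: is_cvg_nneseries => n _ _; exact: edge_measure_ge0.
Qed.

HB.instance Definition _ := isMeasure.Build _ _ _ edge_measure
  edge_measure0 edge_measure_ge0 edge_measure_sigma_additive.

Let edge_measureT : edge_measure setT = 1.
Proof.
rewrite /edge_measure.
under eq_integral do rewrite xsectionE preimage_setT prob_kernel.
by rewrite integral_cst// mul1e; exact: probability_setT.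
Qed.

HB.instance Definition _ :=
  Measure_isProbability.Build _ _ _ edge_measure edge_measureT.

Lemma edge_measureX (A B : set T) : measurable A -> measurable B ->
  edge_measure (A `*` B) = \int[pi]_(x in A) p x B.
Proof.
move=> mA mB; rewrite /edge_measure [RHS]integral_mkcond.
apply: eq_integral => x _; rewrite patchE.
case: ifPn => xA; first by rewrite in_xsectionX.
by rewrite notin_xsectionX// measure0.
Qed.

End edge_measure.

Section rev_edge_measure.
Context {d : measure_display} {T : measurableType d} {R : realType}.
Variables (p : R.-pker T ~> T) (pi : probability T R).

(* The measure pi(dy) p(y, dx). *)
Definition rev_edge_measure (C : set (T * T)) : \bar R :=
  edge_measure p pi [set z | C (z.2, z.1)].

Let measurable_rev (C : set (T * T)) :
  measurable C -> measurable [set z : T * T | C (z.2, z.1)].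
Proof. by move=> mC; rewrite -[X in measurable X]setTI; exact: measurable_swap. Qed.

Let rev_edge_measure0 : rev_edge_measure set0 = 0.
Proof. exact: measure0. Qed.

Let rev_edge_measure_ge0 C : 0 <= rev_edge_measure C.
Proof. exact: measure_ge0. Qed.

Let rev_edge_measure_sigma_additive : semi_sigma_additive rev_edge_measure.
Proof.
move=> F mF /trivIsetP tF mUF; rewrite /rev_edge_measure.
have -> : [set z : T * T | (\bigcup_n F n) (z.2, z.1)] =
    \bigcup_n [set z | F n (z.2, z.1)] by [].
apply: measure_semi_sigma_additive.
- by move=> n; exact: measurable_rev.
- apply/trivIsetP => i j iT jT ij; apply/seteqP; split=> // z /= zF.
  by have := tF i j iT jT ij => /seteqP[+ _] => /(_ (z.2, z.1)); exact.
- by apply: bigcup_measurable => n _; exact: measurable_rev.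
Qed.

HB.instance Definition _ := isMeasure.Build _ _ _ rev_edge_measure
  rev_edge_measure0 rev_edge_measure_ge0 rev_edge_measure_sigma_additive.

Let rev_edge_measureT : rev_edge_measure setT = 1.
Proof. exact: probability_setT. Qed.

HB.instance Definition _ :=
  Measure_isProbability.Build _ _ _ rev_edge_measure rev_edge_measureT.

Lemma rev_edge_measureX (A B : set T) :
  rev_edge_measure (A `*` B) = edge_measure p pi (B `*` A).
Proof. by congr (edge_measure p pi _); apply/seteqP; split=> -[x y] []. Qed.

End rev_edge_measure.

Section very_weak_reversibility.
Context {d : measure_display} {T : measurableType d} {R : realType}.
Variables (p : R.-pker T ~> T) (pi : probability T R).

(* Meaningful when [edge_measure `<< rev_edge_measure]. *)
Definition edge_density : T * T -> \bar R :=
  'd (charge_of_finite_measure (edge_measure p pi)) '/d (rev_edge_measure p pi).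

Definition edge_measures_equivalent :=
  edge_measure p pi `<< rev_edge_measure p pi /\
  rev_edge_measure p pi `<< edge_measure p pi.

(* Changing the density on a null set of pi(dy) p(y, dx) changes
   [edge_density (., y)] on a p(y, .)-null set for pi-almost every y only, so
   the choice of the version is immaterial. *)
Definition very_weak_reversible1 :=
  exists2 q : \bar R, 1 < q &
    ess_sup pi (fun y => 'N[p y]_q[edge_density \o pair^~ y]) < +oo.

End very_weak_reversibility.

Section isoperimetric.
Context {d : measure_display} {T : measurableType d} {R : realType}.
Variables (p : R.-pker T ~> T) (pi : probability T R).

Definition iso_ratio (m : nat) (A : set T) : \bar R :=
  (pi A * pi (~` A))^-1 * \int[pi]_(x in A) kernel_iter p m x (~` A).

Definition iso_const (m : nat) : \bar R :=
  ereal_inf (iso_ratio m @` [set A | measurable A /\ 0 < pi A < 1]).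

(* [\bar R] has 0^-1 = +oo and 0 * +oo = 0, which are exactly the conventions
   a / 0 = +oo for a > 0 and 0 / 0 = 0. *)
Definition escape_ratio (A : set T) (x : T) : \bar R :=
  p x (~` A) / kernel_iter p 2 x (~` A).

(* [mnormalize] only falls back on its second measure when [pi A = 0]. *)
Definition cond_prob (A : set T) (mA : measurable A) : probability T R :=
  mnormalize (mrestr pi mA) pi.

Lemma cond_probE (A : set T) (mA : measurable A) (B : set T) :
  0 < pi A -> cond_prob mA B = pi (A `&` B) / pi A.
Proof.
move=> A0; have Afin : pi A \is a fin_num by exact: fin_num_measure.
pose piA : {measure set T -> \bar R} := mrestr pi mA.
have piAE B' : piA B' = pi (B' `&` A) by [].
rewrite /cond_prob/= /mnormalize -/piA piAE setTI.
rewrite gt_eqF// lt_eqF ?ltey_eq ?Afin//=.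
by rewrite -/piA piAE setIC -[in RHS](fineK Afin) inver fine_eq0// gt_eqF.
Qed.

End isoperimetric.

(* Main.v *)
(* Write [k_m] for the isoperimetric constants and [S f] for the squared
   L^2(pi)-norm of [f].

   A spectral gap gives [n] and [c < 1] with [S (P^n f) <= c S f] for centered
   [f].  For [g = 1_B - pi B] one has [S (g - P g) <= 2 k_1(B) S g], and P is a
   contraction, so [S (g - P^n g) <= n^2 S (g - P g)]; as [P^n g] is much
   shorter than [g], this bounds [k_1(B)] from below.

   Conversely let [k_1 > 0].  Truncating [f_A] at a level [K], its L^r bound
   yields [int_A p(x,A^c) <= K int_A p^2(x,A^c) + eps pi(A)] along [A = A_n],
   whence [k_2 > 0].  Next, with [h = dQ/dQ~],
     [int_{B^c} p^2(x,B) pi(dx)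
        = int pi(dz) p(z,B) int p(z,dx) h(x,z) 1_{B^c}(x)],
   and truncating [h] bounds this by
   [K int p(z,B) p(z,B^c) pi(dz) + eps pi(B)].  So the isoperimetric constant
   of [P^* P] is positive, and a Cheeger inequality in the style of Lawler and
   Sokal bounds the norm of P on centered functions by a constant below 1.
   The limit defining the gap exists by Fekete's lemma. *)

Require Import Defs.
From HB Require Import structures.
From mathcomp Require Import all_boot all_order all_algebra.
From mathcomp Require Import all_classical all_reals all_analysis.
From mathcomp Require Import measurable_realfun ess_sup_inf.
From mathcomp Require Import ring lra.

Set Implicit Arguments.
Unset Strict Implicit.
Unset Printing Implicit Defensive.

Import Order.TTheory GRing.Theory Num.Theory.
Import numFieldNormedType.Exports.

Local Open Scope classical_set_scope.
Local Open Scope ring_scope.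
Local Open Scope ereal_scope.

(** * Integration against the edge measure *)

(** Both truncations serve the same purpose. A bound in L^q with q > 1 is uniform integrability, so
    the error eps may be fixed after the isoperimetric constant k: if pi(A) <= 1/2 then k pi(A)
    pi(A^c) >= (k/2) pi(A), and eps = k/4 leaves half of this.

    The density h can turn an edge round at the price of that error. Turning the first edge of x ->
    z -> B makes z the source of both edges, which produces p(z,B^c) p(z,B). This is why two-step
    flows, hence k_2, control P^* P, and why [escape_ratio] is needed to pass from k_1 to k_2.

    The adjoint P^* is never constructed. Everything happens on pairs (x,y) under Q, where Pu(x) is
    the conditional mean of u(y) given x. Hence the Q-integral of (u(y) - Pu(x))^2 equals S u - S
    (Pu), precisely the loss that the Cheeger inequality must bound from below. *)

Section edge_integrals.
Context {d : measure_display} {T : measurableType d} {R : realType}.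
Variables (p : R.-pker T ~> T) (pi : probability T R).
Local Notation Q := (edge_measure p pi).

Lemma measurable_kernel_section (f : T * T -> \bar R) :
  measurable_fun setT f -> (forall z, 0 <= f z) ->
  measurable_fun setT (fun x => \int[p x]_y f (x, y)).
Proof. by move=> mf f0; exact: measurable_fun_integral_finite_kernel. Qed.

Import HBNNSimple.

Let edge_integral_indic (E : set (T * T)) : measurable E ->
  \int[Q]_z (\1_E z)%:E = \int[pi]_x \int[p x]_y (\1_E (x, y))%:E.
Proof.
move=> mE; rewrite integral_indic// setIT; apply: eq_integral => x _.
rewrite (_ : (fun y => (\1_E (x, y))%:E) = EFin \o \1_(xsection E x)).
  by rewrite integral_indic ?setIT//; exact: measurable_xsection.
by apply/funext => y /=; rewrite !indicE mem_xsection.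
Qed.

Let edge_integral_nnsfun (f : {nnsfun (T * T) >-> R}) :
  \int[Q]_z (f z)%:E = \int[pi]_x \int[p x]_y (f (x, y))%:E.
Proof.
have m1 r : measurable_fun setT (fun z => (\1_(f @^-1` [set r]) z)%:E : \bar R).
  by apply/measurable_EFinP; exact: measurable_indic.
have mE r : measurable_fun setT (fun z => (r * \1_(f @^-1` [set r]) z)%:E).
  by apply/measurable_EFinP; exact: measurable_funM.
have E0 (r : R) z : 0 <= (r * \1_(f @^-1` [set r]) z)%:E.
  by rewrite EFinM nnfun_muleindic_ge0.
under [in LHS]eq_integral do rewrite fimfunE -fsumEFin//.
rewrite ge0_integral_fsum//.
under [in RHS]eq_integral => x _.
  under eq_integral do rewrite fimfunE -fsumEFin//.
  rewrite ge0_integral_fsum//; last first.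
    by move=> r; apply: measurableT_comp (mE r) _; exact: pair1_measurable.
  over.
rewrite /= ge0_integral_fsum//; last 2 first.
- by move=> r; exact: (measurable_kernel_section (mE r)).
- by move=> r x _; apply: integral_ge0.
apply: eq_fsbigr => r _.
under [LHS]eq_integral do rewrite EFinM.
under [RHS]eq_integral do under eq_integral do rewrite EFinM.
(* A negative [r] is not a value of [f]: its preimage is empty and both sides vanish. Only [r >= 0]
   allows the scalar to be pulled out. *)
have [r0|r0] := leP 0%R r; last first.
  rewrite !integral0_eq// => [x _|x _];
    last by rewrite preimage_nnfun0// indic0 mule0.
  by apply: integral0_eq => y _; rewrite preimage_nnfun0// indic0 mule0.
rewrite ge0_integralZl// edge_integral_indic//.
under [RHS]eq_integral => x _.
  rewrite ge0_integralZl//; last first.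
    by apply: measurableT_comp (m1 r) _; exact: pair1_measurable.
  over.
rewrite ge0_integralZl// => [|x _]; last by apply: integral_ge0 => y _.
by apply: (measurable_kernel_section (m1 r)) => z; rewrite lee_fin.
Qed.

(** Tonelli for a kernel: from simple functions, monotone convergence is applied once under [Q],
    once under [pi] and once under each [p x]. *)
Lemma ge0_edge_integral (f : T * T -> \bar R) :
  measurable_fun setT f -> (forall z, 0 <= f z) ->
  \int[Q]_z f z = \int[pi]_x \int[p x]_y f (x, y).
Proof.
move=> mf f0.
pose f_ := nnsfun_approx measurableT mf.
have mf_ n : measurable_fun setT (EFin \o f_ n).
  exact/measurable_EFinP.
have mfx n x : measurable_fun setT (fun y => (f_ n (x, y))%:E).
  by apply: measurableT_comp (mf_ n) _; exact: pair1_measurable.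
have nd_ z : {homo (fun n => (f_ n z)%:E) : m n / (m <= n)%N >-> m <= n}.
  by move=> a b ab; rewrite lee_fin; exact/lefP/nd_nnsfun_approx.
have f_ge0 n z : 0 <= (f_ n z)%:E by rewrite lee_fin.
have limf z : f z = lim ((f_ n z)%:E @[n --> \oo]).
  by apply/esym/cvg_lim => //; exact: cvg_nnsfun_approx.
under eq_integral do rewrite limf.
rewrite monotone_convergence//.
under eq_fun do rewrite edge_integral_nnsfun.
rewrite -monotone_convergence//; last 3 first.
- by move=> n; apply: (measurable_kernel_section (mf_ n)) => z; exact: f_ge0.
- by move=> n x _; exact: integral_ge0.
- by move=> x _ a b ab; apply: ge0_le_integral => // y _; exact: nd_.
apply: eq_integral => x _; rewrite -monotone_convergence//.
by apply: eq_integral => y _; rewrite -limf.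
Qed.

Lemma ge0_edge_integral_fst (f : T -> \bar R) :
  measurable_fun setT f -> (forall z, 0 <= f z) ->
  \int[Q]_z f z.1 = \int[pi]_x f x.
Proof.
move=> mf f0; rewrite ge0_edge_integral//=; last exact: measurableT_comp.
by apply: eq_integral => x _; rewrite integral_cst// prob_kernel mule1.
Qed.

Lemma ge0_rev_edge_integral (f : T * T -> \bar R) :
  measurable_fun setT f -> (forall z, 0 <= f z) ->
  \int[rev_edge_measure p pi]_z f z = \int[pi]_y \int[p y]_x f (x, y).
Proof.
move=> mf f0.
have mswap : measurable_fun setT (fun z : T * T => (z.2, z.1)).
  exact: measurable_swap.
transitivity (\int[pushforward Q (fun z => (z.2, z.1))]_z f z); first by [].
rewrite ge0_integral_pushforward//= ge0_edge_integral//.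
exact: measurableT_comp.
Qed.

Hypothesis pi_inv : invariant_prob p pi.

(** Invariance says exactly that the second marginal of [Q] is [pi]. *)
Lemma ge0_edge_integral_snd (f : T -> \bar R) :
  measurable_fun setT f -> (forall z, 0 <= f z) ->
  \int[Q]_z f z.2 = \int[pi]_x f x.
Proof.
move=> mf f0.
transitivity (\int[pushforward Q snd]_x f x).
  by rewrite ge0_integral_pushforward.
apply: eq_measure_integral => B mB _.
transitivity (Q (snd @^-1` B)); first by [].
by rewrite -setTX edge_measureX// pi_inv.
Qed.

Lemma ge0_invariant_integral (f : T -> \bar R) :
  measurable_fun setT f -> (forall z, 0 <= f z) ->
  \int[pi]_x \int[p x]_y f y = \int[pi]_x f x.
Proof.
move=> mf f0; rewrite -[RHS]ge0_edge_integral_snd//.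
rewrite ge0_edge_integral//.
exact: measurableT_comp.
Qed.

End edge_integrals.

(** * Square-integrable functions *)

Section square_integrable.
Context {d : measure_display} {T : measurableType d} {R : realType}.
Variable mu : probability T R.

Lemma probability_integral_cst (c : R) : \int[mu]_x c%:E = c%:E.
Proof.
rewrite integral_cst// -[RHS]mule1; congr (_ * _); exact: probability_setT.
Qed.

(** Extended-valued, so that norm bounds can be stated before integrability is known, and without a
    root. *)
Definition sqnorm (f : T -> R) : \bar R := \int[mu]_x ((f x) ^+ 2)%:E.

Definition square_integrable (f : T -> R) :=
  measurable_fun setT f /\ sqnorm f < +oo.

Lemma sqnorm_ge0 f : 0 <= sqnorm f.
Proof. by apply: integral_ge0 => x _; rewrite lee_fin sqr_ge0. Qed.

Lemma measurable_sqr (f : T -> R) : measurable_fun setT f ->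
  measurable_fun setT (fun x => ((f x) ^+ 2)%:E).
Proof. by move=> mf; apply/measurable_EFinP; exact: measurable_funX. Qed.

Lemma sqnorm_fin f : square_integrable f -> sqnorm f \is a fin_num.
Proof. by case=> _ ?; rewrite ge0_fin_numE// sqnorm_ge0. Qed.

Lemma ae_le_sqnorm (f g : T -> R) :
  measurable_fun setT f -> measurable_fun setT g ->
  {ae mu, forall x, ((f x) ^+ 2 <= (g x) ^+ 2)%R} -> sqnorm f <= sqnorm g.
Proof.
move=> mf mg fg; apply: ae_ge0_le_integral => //.
- by move=> x _; rewrite lee_fin sqr_ge0.
- exact: measurable_sqr.
- by move=> x _; rewrite lee_fin sqr_ge0.
- exact: measurable_sqr.
- by apply: filterS fg => x fgx _; rewrite lee_fin.
Qed.

Lemma square_integrable_sqr f : square_integrable f ->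
  mu.-integrable setT (fun x => ((f x) ^+ 2)%:E).
Proof.
move=> [mf f2]; apply/integrableP; split; first exact: measurable_sqr.
by under eq_integral do rewrite gee0_abs ?lee_fin ?sqr_ge0//.
Qed.

Lemma square_integrable_integrable f : square_integrable f ->
  mu.-integrable setT (EFin \o f).
Proof.
move=> f2; have [mf _] := f2.
apply: (@le_integrable _ _ _ _ _ measurableT _ (fun x => (1 + (f x) ^+ 2)%:E)).
- exact/measurable_EFinP.
- move=> x _ /=;
  rewrite lee_fin (ger0_norm (addr_ge0 ler01 (sqr_ge0 _))) ler_norml.
  have := sqr_ge0 (f x - 1); have := sqr_ge0 (f x + 1).
  by rewrite !expr2 => ? ?; apply/andP; split; lra.
- rewrite (_ : (fun x => _) = cst 1 \+ (fun x => ((f x) ^+ 2)%:E))//.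
  apply: integrableD => //; last exact: square_integrable_sqr.
  exact: finite_measure_integrable_cst.
Qed.

Lemma square_integrableZ (c : R) f : square_integrable f ->
  square_integrable (fun x => (c * f x)%R).
Proof.
move=> f2; have [mf ffin] := f2; split; first exact: measurable_funM.
rewrite /sqnorm; under eq_integral do rewrite exprMn EFinM.
by rewrite integralZl ?lte_mul_pinfty ?lee_fin ?sqr_ge0 ?square_integrable_sqr.
Qed.

Lemma sqnormZ (c : R) (f : T -> R) : measurable_fun setT f ->
  sqnorm (fun x => (c * f x)%R) = (c ^+ 2)%:E * sqnorm f.
Proof.
move=> mf; rewrite /sqnorm; under eq_integral do rewrite exprMn EFinM.
rewrite ge0_integralZl ?lee_fin ?sqr_ge0//; first exact: measurable_sqr.
by move=> x _; rewrite lee_fin sqr_ge0.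
Qed.

Lemma square_integrableD f g : square_integrable f -> square_integrable g ->
  square_integrable (fun x => (f x + g x)%R).
Proof.
move=> f2 g2; have [mf _] := f2; have [mg _] := g2.
split; first exact: measurable_funD.
apply: (@le_lt_trans _ _ (\int[mu]_x
    (2%:E * ((f x) ^+ 2)%:E + 2%:E * ((g x) ^+ 2)%:E))).
  apply: ge0_le_integral => //.
  - by move=> x _; rewrite lee_fin sqr_ge0.
  - by apply: measurable_sqr; exact: measurable_funD.
  - by apply: emeasurable_funD; apply: measurable_funeM; exact: measurable_sqr.
  - move=> x _; rewrite -!EFinM -EFinD lee_fin.
    by have := sqr_ge0 (f x - g x); rewrite !expr2 => ?; lra.
apply: integrable_lty => //; apply: integrableD => //;
  by apply: integrableZl => //; exact: square_integrable_sqr.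
Qed.

Lemma square_integrableB f g : square_integrable f -> square_integrable g ->
  square_integrable (fun x => (f x - g x)%R).
Proof.
move=> f2 g2.
rewrite (_ : (fun x => _) = (fun x => f x + -1 * g x)%R); last first.
  by apply/funext => x; rewrite mulN1r.
by apply: square_integrableD => //; exact: square_integrableZ.
Qed.

Lemma square_integrable_bounded (f : T -> R) (M : R) : measurable_fun setT f ->
  (forall x, `|f x| <= M)%R -> square_integrable f.
Proof.
move=> mf fM; split => //.
apply: (@le_lt_trans _ _ (\int[mu]_x (M ^+ 2)%:E)).
  apply: ge0_le_integral => //.
  - by move=> x _; rewrite lee_fin sqr_ge0.
  - exact: measurable_sqr.
  - move=> x _; rewrite lee_fin -(real_normK (num_real (f x))).
    by rewrite lerXn2r ?nnegrE// (le_trans _ (fM x)).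
by rewrite probability_integral_cst ltry.
Qed.

Lemma square_integrable_dom (f g : T -> R) : measurable_fun setT f ->
  (forall x, `|f x| <= `|g x|)%R -> square_integrable g -> square_integrable f.
Proof.
move=> mf fg [mg g2]; split => //; apply: le_lt_trans g2.
apply: ae_le_sqnorm => //; apply: nearW => x.
rewrite -(real_normK (num_real (f x))) -(real_normK (num_real (g x))).
by rewrite lerXn2r ?nnegrE.
Qed.

(** Jensen for the square, from integrating [2 m f - m^2 <= f^2] with [m] the mean of [f]. *)
Lemma sqr_Rintegral_le f : square_integrable f ->
  (((\int[mu]_x f x) ^+ 2)%R)%:E <= sqnorm f.
Proof.
move=> f2; have fi := square_integrable_integrable f2.
set m := (\int[mu]_x f x)%R.
have mE : \int[mu]_x (f x)%:E = m%:E
  by rewrite /m /Rintegral fineK// integrable_fin_num.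
have -> : (m ^+ 2)%R%:E = \int[mu]_x ((2 * m)%:E * (f x)%:E - (m ^+ 2)%:E).
  rewrite integralB//; last 2 first.
  - exact: integrableZl.
  - exact: finite_measure_integrable_cst.
  rewrite integralZl// mE probability_integral_cst.
  by rewrite -EFinM -EFinB; congr EFin; ring.
apply: le_integral => //.
- apply: integrableB => //; first exact: integrableZl.
  exact: finite_measure_integrable_cst.
- exact: square_integrable_sqr.
- move=> x _; rewrite -EFinM -EFinB lee_fin.
  by have := sqr_ge0 (f x - m); nra.
Qed.

End square_integrable.

(** * The Markov operator on L^2 *)

Section markov_operator.
Context {d : measure_display} {T : measurableType d} {R : realType}.
Variables (p : R.-pker T ~> T) (pi : probability T R).

(* An alias of [p x] carrying the probability structure, which [p x] itself
   lacks. *)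
Definition kernel_prob (x : T) : set T -> \bar R := p x.

HB.instance Definition _ (x : T) := Measure.copy (kernel_prob x) (p x).

HB.instance Definition _ (x : T) :=
  Measure_isProbability.Build _ _ _ (kernel_prob x) (prob_kernel x).

Lemma measurable_markov_op (f : T -> R) :
  measurable_fun setT f -> measurable_fun setT (markov_op p f).
Proof.
move=> /measurable_EFinP mf; apply: measurableT_comp;
  first exact: fine_measurable.
under eq_fun do rewrite integralE.
apply: emeasurable_funB; apply: measurable_fun_integral_kernel => //.
- by move=> U mU; exact: measurable_kernel.
- exact: measurable_funepos.
- by move=> U mU; exact: measurable_kernel.
- exact: measurable_funeneg.
Qed.

Lemma measurable_iter_markov_op n (f : T -> R) :
  measurable_fun setT f -> measurable_fun setT (iter n (markov_op p) f).
Proof. by move=> mf; elim: n => //= n ih; exact: measurable_markov_op. Qed.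

(** Holds at every [x], without integrability: the positive and negative parts scale separately, and
    if one of their integrals is infinite, [fine] returns 0 on both sides. *)
Lemma markov_opZ (c : R) f x : (0 <= c)%R -> measurable_fun setT f ->
  markov_op p (fun y => c * f y)%R x = (c * markov_op p f x)%R.
Proof.
move=> c0 /measurable_EFinP mf; rewrite /markov_op /Rintegral.
under eq_integral do rewrite EFinM.
rewrite integralE [in RHS]integralE ge0_funeposM// ge0_funenegM//.
rewrite !ge0_integralZl//;
  [|exact: measurable_funeneg|exact: measurable_funepos].
have [->|c_neq0] := eqVneq c 0%R; first by rewrite !mul0e subee// mul0r.
have c_gt0 : (0 < c)%R by rewrite lt0r c_neq0.
move: (\int[p x]_y _) (\int[p x]_y _) => [a| |] [b| |] //=;
  rewrite ?(gt0_muley, gt0_muleNy) ?lte_fin//= ?mulr0//.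
by rewrite mulrBr.
Qed.

Lemma iter_markov_opZ n (c : R) f : (0 <= c)%R -> measurable_fun setT f ->
  iter n (markov_op p) (fun y => c * f y)%R =
  (fun y => c * iter n (markov_op p) f y)%R.
Proof.
move=> c0 mf; elim: n => //= n ->; apply/funext => x.
by rewrite markov_opZ//; exact: measurable_iter_markov_op.
Qed.

Hypothesis pi_inv : invariant_prob p pi.

(** By invariance the integrals of [f^2] under [p x] have [pi]-mean [sqnorm pi f], so they are
    finite almost everywhere. This is where the almost-everywhere restriction on linearity of
    [markov_op] comes from. *)
Lemma ae_kernel_square_integrable f : square_integrable pi f ->
  {ae pi, forall x, square_integrable (kernel_prob x) f}.
Proof.
move=> [mf f2].
have m2 : measurable_fun setT (fun x => \int[p x]_y ((f y) ^+ 2)%:E).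
  apply: measurable_fun_integral_kernel.
  - by move=> U mU; exact: measurable_kernel.
  - by move=> z; rewrite lee_fin sqr_ge0.
  - exact: measurable_sqr.
have : pi.-integrable setT (fun x => \int[p x]_y ((f y) ^+ 2)%:E).
  apply/integrableP; split => //.
  under eq_integral.
    move=> x _; rewrite gee0_abs; last by apply: integral_ge0 => y _;
      rewrite lee_fin sqr_ge0.
    over.
  rewrite /= ge0_invariant_integral//; first exact: measurable_sqr.
  by move=> x; rewrite lee_fin sqr_ge0.
move=> /(integrable_ae measurableT); apply: filterS => x /= /(_ I) fx.
by split => //; rewrite ltey_eq fx.
Qed.

Lemma ae_markov_opE f : square_integrable pi f ->
  {ae pi, forall x, (markov_op p f x)%:E = \int[p x]_y (f y)%:E}.
Proof.
move=> /ae_kernel_square_integrable; apply: filterS => x fx.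
rewrite /markov_op /Rintegral fineK//; apply: integrable_fin_num => //.
exact: (square_integrable_integrable fx).
Qed.

(** Jensen under each [p x], then invariance applied to [f^2]. *)
Lemma sqnorm_markov_op f : square_integrable pi f ->
  sqnorm pi (markov_op p f) <= sqnorm pi f.
Proof.
move=> f2; have [mf _] := f2.
rewrite [leRHS]/sqnorm -(ge0_invariant_integral pi_inv); last 2 first.
- exact: measurable_sqr.
-
by move=> x; rewrite lee_fin sqr_ge0.
apply: ae_ge0_le_integral => //.
- by move=> x _; rewrite lee_fin sqr_ge0.
- exact/measurable_sqr/measurable_markov_op.
- by move=> x _; apply: integral_ge0 => y _; rewrite lee_fin sqr_ge0.
- apply: measurable_fun_integral_kernel.
  - by move=> U mU; exact: measurable_kernel.
  - by move=> z; rewrite lee_fin sqr_ge0.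
  - exact: measurable_sqr.
- apply: filterS (ae_kernel_square_integrable f2) => x fx _.
  exact: (sqr_Rintegral_le fx).
Qed.

Lemma square_integrable_markov_op f : square_integrable pi f ->
  square_integrable pi (markov_op p f).
Proof.
move=> f2; have [mf ffin] := f2; split; first exact: measurable_markov_op.
exact: le_lt_trans (sqnorm_markov_op f2) _.
Qed.

Lemma square_integrable_iter n f : square_integrable pi f ->
  square_integrable pi (iter n (markov_op p) f).
Proof. by move=> f2; elim: n => //= n; exact: square_integrable_markov_op. Qed.

Lemma ae_markov_opB f g : square_integrable pi f -> square_integrable pi g ->
  {ae pi, forall x, markov_op p (fun y => f y - g y)%R x =
    (markov_op p f x - markov_op p g x)%R}.
Proof.
move=> /ae_kernel_square_integrable f2 /ae_kernel_square_integrable g2.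
apply: filterS2 f2 g2 => x fx gx; rewrite /markov_op RintegralB//.
- exact: (square_integrable_integrable fx).
- exact: (square_integrable_integrable gx).
Qed.

Lemma sqnorm_markov_opB f g : square_integrable pi f -> square_integrable pi g
  ->
  sqnorm pi (fun x => markov_op p f x - markov_op p g x)%R <=
  sqnorm pi (fun x => f x - g x)%R.
Proof.
move=> f2 g2; have [mf _] := f2; have [mg _] := g2.
apply: le_trans (sqnorm_markov_op (square_integrableB f2 g2)).
apply: ae_le_sqnorm.
- by apply: measurable_funB; exact: measurable_markov_op.
- by apply: measurable_markov_op; exact: measurable_funB.
- by apply: filterS (ae_markov_opB f2 g2) => x ->.
Qed.

(** Invariance is available for nonnegative functions, hence the split into positive and negative
    parts, both with finite integral. *)
Lemma integral_markov_op f : square_integrable pi f ->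
  \int[pi]_x (markov_op p f x)%:E = \int[pi]_x (f x)%:E.
Proof.
move=> f2; have [/measurable_EFinP mf _] := f2.
have fi := square_integrable_integrable f2.
have mpos := measurable_funepos mf; have mneg := measurable_funeneg mf.
have mint g : measurable_fun setT g -> (forall x : T, 0 <= g x) ->
    measurable_fun setT (fun x => \int[p x]_y g y).
  move=> mg g0; apply: measurable_fun_integral_kernel => // U mU.
  exact: measurable_kernel.
have iint g : measurable_fun setT g -> (forall x : T, 0 <= g x) ->
    \int[pi]_x g x < +oo -> pi.-integrable setT (fun x => \int[p x]_y g y).
  move=> mg g0 gfin; apply/integrableP; split; first exact: mint.
  under eq_integral do rewrite gee0_abs ?integral_ge0//.
  by rewrite ge0_invariant_integral.
transitivity (\int[pi]_x (\int[p x]_y (EFin \o f)^\+ y - \int[p x]_y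
  (EFin \o f)^\- y)).
  apply: ae_eq_integral => //.
  - by apply/measurable_EFinP; apply: measurable_markov_op;
    exact/measurable_EFinP.
  - by apply: emeasurable_funB; exact: mint.
  - by apply: filterS (ae_markov_opE f2) => x -> _; rewrite integralE.
rewrite integralB//; last 2 first.
- by apply: iint => //; exact: integral_funepos_lt_pinfty fi.
- by apply: iint => //; exact: integral_funeneg_lt_pinfty fi.
by rewrite !ge0_invariant_integral// -integralE.
Qed.

End markov_operator.

(** * Layer cake formula and medians *)

Section layer_cake_median.
Context {d : measure_display} {T : measurableType d} {R : realType}.
Variables (P : probability T R) (f : T -> R).
Hypothesis mf : measurable_fun setT f.

Let X : {RV P >-> R} := mfun_Sub (mem_set mf : f \in mfun).

Lemma measurable_superlevel (t : R) : measurable [set x | (t < f x)%R].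
Proof.
rewrite (_ : [set x | _] = f @^-1` `]t, +oo[%classic).
  by rewrite -[X in measurable X]setTI; exact: mf.
by apply/seteqP; split => x /=; rewrite in_itv/= andbT.
Qed.

Lemma measurable_sublevel (t : R) : measurable [set x | (f x <= t)%R].
Proof.
rewrite (_ : [set x | _] = f @^-1` `]-oo, t]%classic).
  by rewrite -[X in measurable X]setTI; exact: mf.
by apply/seteqP; split => x /=; rewrite in_itv.
Qed.

Let ccdfE t : ccdf X t = P [set x | (t < f x)%R].
Proof.
transitivity (P (f @^-1` `]t, +oo[%classic)); first by [].
by congr (P _); apply/seteqP; split => x /=; rewrite in_itv/= andbT.
Qed.

Lemma measurable_measure_superlevel :
  measurable_fun setT (fun t : R => P [set x | (t < f x)%R]).
Proof. by under eq_fun do rewrite -ccdfE; exact: ccdf_measurable. Qed.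

Lemma ge0_layer_cake : (forall x, 0 <= f x)%R ->
  \int[P]_x (f x)%:E =
  \int[lebesgue_measure]_(t in `[0%R, +oo[) P [set x | (t < f x)%R].
Proof.
move=> f0; under [RHS]eq_integral do rewrite -ccdfE.
by rewrite -ge0_expectation_ccdf// expectation_def.
Qed.

(** Continuity from below along the closed sublevel sets at [c - 1/(n+1)]. *)
Lemma measure_lt_le (c : R) (h : \bar R) :
  (forall n : nat, P [set x | f x <= c - n.+1%:R^-1]%R <= h) ->
  P [set x | f x < c]%R <= h.
Proof.
move=> Ph.
pose F (n : nat) := [set x | f x <= c - n.+1%:R^-1]%R.
have mF n : measurable (F n) by exact: measurable_sublevel.
have -> : [set x | f x < c]%R = \bigcup_n F n.
  apply/seteqP; split => [x /= fxc|x [n _] /=]; last first.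
    by move=> /le_lt_trans; apply; rewrite ltrBlDr ltrDl invr_gt0.
  have cf : (0 < (c - f x)^-1)%R by rewrite invr_gt0 subr_gt0.
  exists (Num.bound ((c - f x)^-1)) => //.
  rewrite /F/= lerBrDr -lerBrDl -[leRHS]invrK lef_pV2 ?posrE//.
  rewrite ltW// (lt_le_trans (archi_boundP (ltW cf)))//.
  by rewrite ler_nat.
have mU : measurable (\bigcup_n F n) by exact: bigcup_measurable.
have ndF : {homo F : n m / (n <= m)%N >-> (n <= m)%O}.
  move=> m n mn; apply/subsetPset => x; rewrite /F/= => /le_trans; apply.
  by rewrite lerD2l lerN2 lef_pV2 ?posrE ?ltr0n// ler_nat.
have Fcvg := nondecreasing_cvg_mu (mu := P) mF mU ndF.
rewrite -(cvg_lim _ Fcvg)//; apply: lime_le; first exact: cvgP Fcvg.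
exact: nearW.
Qed.

End layer_cake_median.

(** The median is the infimum of the levels at which the distribution function has reached 1/2; its
    limits 1 and 0 at the two ends make this infimum finite. *)
Lemma exists_median {d : measure_display} {T : measurableType d} {R : realType}
    (P : probability T R) (f : T -> R) : measurable_fun setT f ->
  exists c : R, P [set x | f x < c]%R <= 2^-1%:E /\
    P [set x | c < f x]%R <= 2^-1%:E.
Proof.
move=> mf.
pose X : {RV P >-> R} := mfun_Sub (mem_set mf : f \in mfun).
have cdfE t : cdf X t = P [set x | f x <= t]%R.
  transitivity (P (f @^-1` `]-oo, t]%classic)); first by [].
  by congr (P _); apply/seteqP; split => x /=; rewrite in_itv.
pose S := [set t | 2^-1%:E <= cdf X t].
have cdf_fin t : cdf X t \is a fin_num by rewrite cdfE fin_num_measure//;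
  exact: measurable_sublevel.
have S0 : S !=set0.
  have /fine_cvg/cvgr_gt/(_ (2^-1)%R) := cvg_cdfy1 X.
  rewrite invf_lt1// ltr1n => /(_ isT) /filter_ex[t /= ht].
  by exists t; rewrite /S/= -(fineK (cdf_fin t)) lee_fin ltW.
have Slb : has_lbound S.
  have /fine_cvg/cvgr_lt/(_ (2^-1)%R) := cvg_cdfNy0 X.
  rewrite invr_gt0 ltr0n => /(_ isT) /filter_ex[t /= ht].
  exists t => s; rewrite /S/= -(fineK (cdf_fin s)) lee_fin => hs.
  rewrite leNgt; apply/negP => st.
  have : (fine (cdf X s) <= fine (cdf X t))%R.
    by rewrite fine_le//; apply: cdf_nondecreasing; exact: ltW.
  lra.
exists (inf S); split.
- apply: measure_lt_le => // n; rewrite -cdfE leNgt; apply/negP => /ltW Sc.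
  have := inf_lbound Slb Sc.
  by rewrite leNgt ltrBlDr ltrDl invr_gt0 ltr0n.
- have mNf : measurable_fun setT (fun x => - f x)%R by exact: measurable_funN.
  rewrite (_ : [set x | _] = [set x | - f x < - inf S]%R); last first.
    by apply/seteqP; split => x /=; rewrite ltrN2.
  apply: measure_lt_le => // n.
  have n0 : (0 < n.+1%:R^-1 :> R)%R by rewrite invr_gt0.
  (* Some level [t] of [S] lies below [inf S + 1/(n+1)], so [f >= inf S + 1/(n+1)] forces [f > t],
     an event of mass at most 1/2. *)
  have [t St tS] := inf_adherent n0 (conj S0 Slb).
have mt := measurable_sublevel mf t.
  apply: (@le_trans _ _ (P (~` [set x | f x <= t]%R))).
    apply: le_measure; rewrite ?inE.
    + exact: measurable_sublevel.
    + exact: measurableC.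
    + move=> x /=; rewrite lerNl opprB opprK => fx /(le_trans fx).
      by rewrite addrC leNgt tS.
  rewrite probability_setC// -cdfE.
  move: St; rewrite /S/= -(fineK (cdf_fin t)) -EFinB !lee_fin; lra.
Qed.

(** * Cheeger inequality *)

Section cheeger.
Context {d : measure_display} {T : measurableType d} {R : realType}.
Variables (p : R.-pker T ~> T) (pi : probability T R).
Local Notation Q := (edge_measure p pi).

(* [<1_(~` B), P^* P 1_B>], the flow between [B] and its complement under the
   reversible kernel P^* P. *)
Definition spread (B : set T) : \bar R := \int[pi]_z (p z B * p z (~` B)).

Lemma measurable_spread_fun (B : set T) : measurable B ->
  measurable_fun setT (fun z => p z B * p z (~` B)).
Proof.
move=> mB; apply: emeasurable_funM; apply: measurable_kernel => //.
exact: measurableC.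
Qed.

Lemma kernel_setC x (B : set T) : measurable B -> p x (~` B) = 1 - p x B.
Proof. by move=> mB; exact: (@probability_setC _ _ _ (kernel_prob p x)). Qed.

Lemma kernel_fin_num x (B : set T) : measurable B -> p x B \is a fin_num.
Proof. by move=> mB; exact: (@fin_num_measure _ _ _ (kernel_prob p x)). Qed.

Lemma kernel_le1 x (B : set T) : measurable B -> p x B <= 1.
Proof. by move=> mB; exact: (@probability_le1 _ _ _ (kernel_prob p x)). Qed.

Lemma edge_setI_spread_le (D B : set T) : measurable D -> measurable B ->
  Q ((D `*` setT) `&` (setT `*` B)) + spread B <=
  Q ((D `*` setT) `|` (setT `*` B)).
Proof.
move=> mD mB.
have mI : measurable ((D `*` setT) `&` (setT `*` B)).
  by apply: measurableI; exact: measurableX.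
have mU : measurable ((D `*` setT) `|` (setT `*` B)).
  by apply: measurableU; exact: measurableX.
have mQ C : measurable C -> measurable_fun setT (fun x => p x (xsection C x)).
  by move=> mC; apply: measurable_fun_xsection_finite_kernel; rewrite inE.
rewrite /spread -ge0_integralD//; last 2 first.
- exact: mQ.
- exact: measurable_spread_fun.
apply: ge0_le_integral => //.
- by move=> x _; rewrite adde_ge0// mule_ge0.
- by apply: emeasurable_funD; [exact: mQ|exact: measurable_spread_fun].
- exact: mQ.
move=> z _; have [zD|zD] := pselect (D z).
- have -> : xsection ((D `*` setT) `&` (setT `*` B)) z = B.
    by apply/seteqP; split => y; rewrite /xsection/= inE/=; tauto.
  have -> : xsection ((D `*` setT) `|` (setT `*` B)) z = setT.
    by apply/seteqP; split => y; rewrite /xsection/= inE/=; tauto.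
  rewrite prob_kernel kernel_setC//.
  have : p z B <= 1 by exact: kernel_le1.
  rewrite -(fineK (kernel_fin_num z mB)) -EFinB -EFinM -EFinD !lee_fin => h.
  have := sqr_ge0 (1 - fine (p z B)); rewrite expr2; lra.
- have -> : xsection ((D `*` setT) `&` (setT `*` B)) z = set0.
    by apply/seteqP; split => y; rewrite /xsection/= inE/=; tauto.
  have -> : xsection ((D `*` setT) `|` (setT `*` B)) z = B.
    by apply/seteqP; split => y; rewrite /xsection/= inE/=; tauto.
  rewrite measure0 add0e -[leRHS]mule1 lee_pmul// kernel_le1//.
  exact: measurableC.
Qed.

Hypothesis pi_inv : invariant_prob p pi.
Variable k : R.
Hypothesis k_gt0 : (0 < k)%R.
Hypothesis k_spread : forall B, measurable B -> pi B <= 2^-1%:E ->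
  k%:E * pi B <= spread B.

Section nonnegative.
Variable u : T -> R.
Hypotheses (u2 : square_integrable pi u) (u0 : (forall x, 0 <= u x)%R).
Hypothesis u_half : pi [set x | 0 < u x]%R <= 2^-1%:E.

Let mu := u2.1.
Let m := markov_op p u.
Let mm : measurable_fun setT m := measurable_markov_op p mu.
Let m0 x : (0 <= m x)%R.
Proof. by apply: Rintegral_ge0. Qed.

Let a (z : T * T) : R := ((u z.2) ^+ 2)%R.
Let b (z : T * T) : R := ((m z.1) ^+ 2)%R.
Let ma : measurable_fun setT a.
Proof. by apply: measurable_funX; exact: measurableT_comp. Qed.
Let mb : measurable_fun setT b.
Proof. by apply: measurable_funX; exact: measurableT_comp. Qed.
Let a0 z : (0 <= a z)%R. Proof. exact: sqr_ge0. Qed.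
Let b0 z : (0 <= b z)%R. Proof. exact: sqr_ge0. Qed.

Let N : R := fine (sqnorm pi u).
Let N' : R := fine (sqnorm pi m).
Let NE : sqnorm pi u = N%:E.
Proof. by rewrite fineK// sqnorm_fin. Qed.
Let N'E : sqnorm pi m = N'%:E.
Proof. by rewrite fineK// sqnorm_fin//; exact: square_integrable_markov_op. Qed.

Let integral_a : \int[Q]_z (a z)%:E = N%:E.
Proof.
rewrite -NE /sqnorm -(ge0_edge_integral_snd (p := p) pi_inv)//.
- exact: measurable_sqr.
- by move=> x; rewrite lee_fin sqr_ge0.
Qed.

Let integral_b : \int[Q]_z (b z)%:E = N'%:E.
Proof.
rewrite -N'E /sqnorm -(ge0_edge_integral_fst p)//.
- exact: measurable_sqr.
- by move=> x; rewrite lee_fin sqr_ge0.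
Qed.

(** Since [m] is the conditional mean of [u], the cross term is again [N']; thus [(u y - m x)^2]
    integrates to [N - N'] and [(u y + m x)^2] to [N + 3 N']. *)
Let integral_ab : \int[Q]_z (u z.2 * m z.1)%:E = N'%:E.
Proof.
have mum : measurable_fun setT (fun z : T * T => (u z.2 * m z.1)%:E).
  by apply/measurable_EFinP; apply: measurable_funM; exact: measurableT_comp.
rewrite ge0_edge_integral//; last by move=> z; rewrite lee_fin mulr_ge0.
rewrite -N'E /sqnorm; apply: ae_eq_integral => //.
- by apply: (measurable_kernel_section p mum) => z; rewrite lee_fin mulr_ge0.
- exact: measurable_sqr.
apply: filterS (ae_markov_opE pi_inv u2) => x mxE _ /=.
under eq_integral do rewrite mulrC EFinM.
rewrite ge0_integralZl_EFin//; last 2 first.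
- by move=> y _; rewrite lee_fin.
- exact/measurable_EFinP.
by rewrite -mxE -EFinM expr2.
Qed.

(* Comparing max and min, rather than integrating [|a - b|], reduces the layer
   cake argument to superlevel sets. *)
Let level_gap (t : R) : (0 <= t)%R ->
  Q [set z | t < Num.min (a z) (b z)]%R +
    k%:E * pi [set x | t < (u x) ^+ 2]%R <=
  Q [set z | t < Num.max (a z) (b z)]%R.
Proof.
move=> t0.
pose B := [set x | t < (u x) ^+ 2]%R; pose D := [set x | t < (m x) ^+ 2]%R.
have mB : measurable B by apply: measurable_superlevel; exact: measurable_funX.
have mD : measurable D by apply: measurable_superlevel; exact: measurable_funX.
have -> : [set z | t < Num.min (a z) (b z)]%R =
    (D `*` setT) `&` (setT `*` B).
  apply/seteqP; split => z /=; rewrite lt_min; first by case/andP.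
  by move=> [[? _] [_ ?]]; apply/andP.
have -> : [set z | t < Num.max (a z) (b z)]%R =
    (D `*` setT) `|` (setT `*` B).
  apply/seteqP; split => z /=; rewrite lt_max.
    by case/orP => ?; [right|left].
  by move=> [[h _]|[_ h]]; apply/orP; [right|left].
apply: le_trans (edge_setI_spread_le mD mB); apply: leeD2l;
  apply: k_spread => //.
apply: le_trans u_half; apply: le_measure; rewrite ?inE//.
  exact: measurable_superlevel.
move=> x; rewrite /B/= => tu; rewrite lt0r u0 andbT; apply: contraTneq tu => ->.
by rewrite expr0n/= -leNgt.
Qed.

Let mmin : measurable_fun setT (fun z => Num.min (a z) (b z)).
Proof. exact: measurable_minr. Qed.
Let mmax : measurable_fun setT (fun z => Num.max (a z) (b z)).
Proof. exact: measurable_maxr. Qed.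

(** The co-area step: [level_gap] integrated over [t >= 0]. As max - min is [|a - b|], it bounds the
    integral of [|a - b|] below by [k * N]. *)
Let min_max_gap : \int[Q]_z (Num.min (a z) (b z))%:E + (k * N)%:E <=
  \int[Q]_z (Num.max (a z) (b z))%:E.
Proof.
rewrite ge0_layer_cake//; last by move=> z; rewrite le_min a0 b0.
rewrite [leRHS]ge0_layer_cake//; last by move=> z; rewrite le_max a0.
rewrite EFinM -NE /sqnorm ge0_layer_cake//; last 2 first.
- exact: measurable_funX.
- by move=> z; rewrite sqr_ge0.
have m1 := measurable_measure_superlevel Q mmin.
have m2 := measurable_measure_superlevel Q mmax.
have m3 := measurable_measure_superlevel pi (measurable_funX 2 mu).
rewrite -ge0_integralZl//; last 2 first.
- exact: measurable_funTS m3.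
- by rewrite lee_fin ltW.
rewrite -ge0_integralD//; last 3 first.
- exact: measurable_funTS m1.
- by move=> t _; rewrite mule_ge0// lee_fin ltW.
- by apply: measurable_funeM; exact: measurable_funTS m3.
apply: ge0_le_integral => //.
- by move=> t _; rewrite adde_ge0// mule_ge0// lee_fin ltW.
- apply: emeasurable_funD; first exact: measurable_funTS m1.
  by apply: measurable_funeM; exact: measurable_funTS m3.
- exact: measurable_funTS m2.
- by move=> t /=; rewrite in_itv/= andbT; exact: level_gap.
Qed.

(* AM-GM: [|x^2 - y^2| <= k/8 (x + y)^2 + 2/k (x - y)^2], with the cross terms
   moved so that both sides are sums of nonnegative terms. *)
Let max_le_min (x y : R) : (0 <= x)%R -> (0 <= y)%R ->
  (Num.max (x ^+ 2) (y ^+ 2) + 4 / k * (x * y) <=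
   Num.min (x ^+ 2) (y ^+ 2) + (k / 8 + 2 / k) * (x ^+ 2 + y ^+ 2) +
     k / 4 * (x * y))%R.
Proof.
move=> x0 y0.
have k_neq0 : k != 0%R by rewrite gt_eqF.
have key (s t : R) : (s ^+ 2 + 4 / k * (s * t) <=
    t ^+ 2 + (k / 8 + 2 / k) * (s ^+ 2 + t ^+ 2) + k / 4 * (s * t))%R.
  rewrite -subr_ge0.
  rewrite [leRHS](_ : _ = (k / 8 * ((s + t) - 4 / k * (s - t)) ^+ 2)%R).
    by rewrite mulr_ge0 ?sqr_ge0// divr_ge0 ?ltW.
  by field.
have [xy|yx] := leP (x ^+ 2)%R (y ^+ 2)%R; last exact: key.
by have := key y x; rewrite (mulrC y x) (addrC (y ^+ 2)%R (x ^+ 2)%R).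
Qed.

(** [min_max_gap] and [max_le_min] give [k N <= k/8 (N + 3 N') + 2/k (N - N')]. With [N' <= N] the
    first term is at most [k/2 N], which leaves [k^2/4 N <= N - N']. *)
Lemma sqnorm_markov_op_ge0_half :
  sqnorm pi (markov_op p u) <= (1 - k ^+ 2 / 4)%:E * sqnorm pi u.
Proof.
rewrite -/m NE N'E -EFinM lee_fin.
have NN' : (N' <= N)%R by rewrite -lee_fin -NE -N'E; exact: sqnorm_markov_op.
have N'0 : (0 <= N')%R by rewrite -lee_fin -N'E sqnorm_ge0.
have kV0 : (0 < k^-1)%R by rewrite invr_gt0.
have mum : measurable_fun setT (fun z : T * T => (u z.2 * m z.1)%R).
  by apply: measurable_funM; exact: measurableT_comp.
(* The integral of the minimum occurs on both sides of the final inequality and must be finite to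
   cancel. *)
set I := \int[Q]_z (Num.min (a z) (b z))%:E.
have Ifin : I \is a fin_num.
  rewrite ge0_fin_numE; last first.
    by apply: integral_ge0 => z _; rewrite lee_fin le_min a0 b0.
  apply: (@le_lt_trans _ _ N%:E); last by rewrite ltry.
  rewrite -integral_a; apply: ge0_le_integral => //.
  - by move=> z _; rewrite lee_fin le_min a0 b0.
  - exact/measurable_EFinP.
  - exact/measurable_EFinP.
  - by move=> z _; rewrite lee_fin ge_min lexx.
have : \int[Q]_z ((Num.max (a z) (b z))%:E + (4 / k)%:E * (u z.2 * m z.1)%:E) <=
    \int[Q]_z ((Num.min (a z) (b z))%:E +
      ((k / 8 + 2 / k)%:E * ((a z)%:E + (b z)%:E) +
       (k / 4)%:E * (u z.2 * m z.1)%:E)).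
  apply: ge0_le_integral => //.
  - move=> z _; rewrite -EFinM -EFinD lee_fin addr_ge0 ?le_max ?a0//.
    by rewrite !mulr_ge0// ltW.
  - apply: emeasurable_funD; first exact/measurable_EFinP.
    by apply: measurable_funeM; exact/measurable_EFinP.
  - apply: emeasurable_funD; first exact/measurable_EFinP.
    apply: emeasurable_funD; apply: measurable_funeM;
      last exact/measurable_EFinP.
    by apply: emeasurable_funD; exact/measurable_EFinP.
  - move=> z _; rewrite -?(EFinM,EFinD) lee_fin addrA.
    exact: max_le_min.
have mmaxE : measurable_fun setT (fun z => (Num.max (a z) (b z))%:E).
  exact/measurable_EFinP.
have mminE : measurable_fun setT (fun z => (Num.min (a z) (b z))%:E).
  exact/measurable_EFinP.
have maE : measurable_fun setT (fun z => (a z)%:E) by exact/measurable_EFinP.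
have mbE : measurable_fun setT (fun z => (b z)%:E) by exact/measurable_EFinP.
have mumE : measurable_fun setT (fun z : T * T => (u z.2 * m z.1)%:E).
  exact/measurable_EFinP.
have um0 (z : T * T) : 0 <= (u z.2 * m z.1)%:E by rewrite lee_fin mulr_ge0.
have max0 z : 0 <= (Num.max (a z) (b z))%:E by rewrite lee_fin le_max a0.
have min0 z : 0 <= (Num.min (a z) (b z))%:E by rewrite lee_fin le_min a0 b0.
have ab0 z : 0 <= (a z)%:E + (b z)%:E by rewrite adde_ge0// lee_fin.
have c1 : 0 <= (4 / k)%:E by rewrite lee_fin divr_ge0// ltW.
have c2 : 0 <= (k / 8 + 2 / k)%:E by rewrite lee_fin addr_ge0// divr_ge0// ltW.
have c3 : 0 <= (k / 4)%:E by rewrite lee_fin divr_ge0// ltW.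
rewrite ge0_integralD//; last 2 first.
- by move=> z _; rewrite mule_ge0.
- exact: measurable_funeM.
rewrite [leRHS]ge0_integralD//; last 2 first.
- by move=> z _; rewrite adde_ge0// mule_ge0.
- by apply: emeasurable_funD; apply: measurable_funeM => //;
  exact: emeasurable_funD.
rewrite [X in _ <= _ + X]ge0_integralD//; last 4 first.
- by move=> z _; rewrite mule_ge0.
- by apply: measurable_funeM; exact: emeasurable_funD.
- by move=> z _; rewrite mule_ge0.
- exact: measurable_funeM.
rewrite !ge0_integralZl//; last first.
- exact: emeasurable_funD.
rewrite [X in (k / 8 + 2 / k)%:E * X]ge0_integralD//; last 2 first.
- by move=> z _; rewrite lee_fin.
- by move=> z _; rewrite lee_fin.
rewrite integral_a integral_b integral_ab.
move/(le_trans (leeD2r _ min_max_gap)).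
rewrite -/I -(fineK Ifin) -?(EFinM,EFinD) lee_fin => h.
(* The factor [k / 2] clears the denominators for [lra]. *)
have {}h : (k / 2 * (k * N + 4 / k * N') <=
    k / 2 * ((k / 8 + 2 / k) * (N + N') + k / 4 * N'))%R.
  by rewrite ler_pM2l ?divr_gt0//; lra.
have E1 : (k / 2 * (k * N + 4 / k * N') = k ^+ 2 * N / 2 + 2 * N')%R.
  by field; rewrite gt_eqF.
have E2 : (k / 2 * ((k / 8 + 2 / k) * (N + N') + k / 4 * N') =
    (k ^+ 2 / 16 + 1) * (N + N') + k ^+ 2 / 8 * N')%R.
  by field; rewrite gt_eqF.
rewrite E1 E2 in h.
have : (0 <= k ^+ 2 * (N - N'))%R by rewrite mulr_ge0 ?sqr_ge0// subr_ge0.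
lra.
Qed.

End nonnegative.

(** Applied to [f] and to [Pf], both centered: shifting by a median costs the same [c^2] on either
    side. *)
Lemma sqnorm_subr_cst (f : T -> R) (c : R) : square_integrable pi f ->
  \int[pi]_x (f x)%:E = 0 ->
  sqnorm pi (fun x => f x - c)%R = sqnorm pi f + (c ^+ 2)%:E.
Proof.
move=> f2 f0; have fi := square_integrable_integrable f2.
have fs := square_integrable_sqr f2.
have ci := finite_measure_integrable_cst pi (c ^+ 2).
rewrite -[X in _ + X](probability_integral_cst pi) /sqnorm.
(* The vanishing integral of [2 c f] is inserted so that the integrands agree pointwise. *)
rewrite -[LHS]addr0.
have <- : \int[pi]_x ((2 * c)%:E * (f x)%:E) = 0.
  by rewrite integralZl// f0 mule0.
rewrite -integralD//; last 2 first.
- apply: square_integrable_sqr; apply: square_integrableB => //.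
  by apply: (@square_integrable_bounded _ _ _ _ (cst c) `|c|%R).
- exact: integrableZl.
rewrite -[RHS]integralD//; last exact: ci.
apply: eq_integral => x _.
by rewrite -EFinM -!EFinD; congr EFin; ring.
Qed.

(* Apply the nonnegative case to both parts of [f - c], [c] a median of [f]; as
   [P u] and [P v] are nonnegative, [(P u - P v)^2 <= (P u)^2 + (P v)^2]. *)
Lemma sqnorm_markov_op_contraction (f : T -> R) : square_integrable pi f ->
  \int[pi]_x (f x)%:E = 0 ->
  sqnorm pi (markov_op p f) <= (1 - k ^+ 2 / 4)%:E * sqnorm pi f.
Proof.
move=> f2 f0; have [mf _] := f2.
have [c [cl cr]] := exists_median pi mf.
pose u x := Num.max (f x - c)%R 0%R.
pose v x := Num.max (c - f x)%R 0%R.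
have c2 : square_integrable pi (cst c).
  exact: (@square_integrable_bounded _ _ _ _ (cst c) `|c|%R).
have fc2 : square_integrable pi (fun x => f x - c)%R.
  exact: (square_integrableB f2 c2).
have [mfc _] := fc2.
have u2 : square_integrable pi u.
  apply: square_integrable_dom fc2; first exact: measurable_maxr.
  move=> x; rewrite /u; have [h|h] := leP (f x - c)%R 0%R => //.
  by rewrite normr0.
have v2 : square_integrable pi v.
  apply: square_integrable_dom fc2.
    by apply: measurable_maxr => //; exact: measurable_funB.
  move=> x; rewrite /v distrC; have [h|h] := leP (c - f x)%R 0%R => //.
  by rewrite normr0.
have [mu _] := u2; have [mv _] := v2.
have u0 x : (0 <= u x)%R by rewrite le_max lexx orbT.
have v0 x : (0 <= v x)%R by rewrite le_max lexx orbT.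
have uvE x : (f x - c = u x - v x)%R.
  rewrite /u /v; have [h|h] := leP (f x - c)%R 0%R;
    have [h'|h'] := leP (c - f x)%R 0%R; lra.
have uv0 x : (u x * v x = 0)%R.
  rewrite /u /v; have [h|h] := leP (f x - c)%R 0%R; first by rewrite mul0r.
  by have [h'|h'] := leP (c - f x)%R 0%R; [rewrite mulr0|lra].
have Pu0 x : (0 <= markov_op p u x)%R by exact: Rintegral_ge0.
have Pv0 x : (0 <= markov_op p v x)%R by exact: Rintegral_ge0.
have uN : sqnorm pi (markov_op p u) <= (1 - k ^+ 2 / 4)%:E * sqnorm pi u.
  apply: sqnorm_markov_op_ge0_half => //.
  apply: le_trans cr; rewrite le_eqVlt; apply/orP; left; apply/eqP;
    congr (pi _).
  by apply/seteqP; split => x /=; rewrite /u lt_max ltxx orbF subr_gt0.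
have vN : sqnorm pi (markov_op p v) <= (1 - k ^+ 2 / 4)%:E * sqnorm pi v.
  apply: sqnorm_markov_op_ge0_half => //.
  apply: le_trans cl; rewrite le_eqVlt; apply/orP; left; apply/eqP;
    congr (pi _).
  by apply/seteqP; split => x /=; rewrite /v lt_max ltxx orbF subr_gt0.
have Pf2 := square_integrable_markov_op pi_inv f2.
have Pu2 := square_integrable_markov_op pi_inv u2.
have Pv2 := square_integrable_markov_op pi_inv v2.
have Pf0 : \int[pi]_x (markov_op p f x)%:E = 0 by rewrite integral_markov_op.
have fE := sqnorm_subr_cst c f2 f0.
have PfE := sqnorm_subr_cst c Pf2 Pf0.
have fcE : sqnorm pi (fun x => f x - c)%R = sqnorm pi u + sqnorm pi v.
  rewrite /sqnorm -ge0_integralD//; last 4 first.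
  - by move=> x _; rewrite lee_fin sqr_ge0.
  - exact: measurable_sqr.
  - by move=> x _; rewrite lee_fin sqr_ge0.
  - exact: measurable_sqr.
  apply: eq_integral => x _; rewrite -EFinD uvE; congr EFin.
  by have := uv0 x; rewrite sqrrB => ->; rewrite mul0rn subr0.
have Pcst x : markov_op p (cst c) x = c.
  have := probability_integral_cst (kernel_prob p x) c.
  by rewrite /markov_op /Rintegral => ->.
have : sqnorm pi (fun x => markov_op p f x - c)%R <=
    sqnorm pi (markov_op p u) + sqnorm pi (markov_op p v).
  rewrite /sqnorm -ge0_integralD//; last 4 first.
  - by move=> x _; rewrite lee_fin sqr_ge0.
  - exact: measurable_sqr Pu2.1.
  - by move=> x _; rewrite lee_fin sqr_ge0.
  - exact: measurable_sqr Pv2.1.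
  apply: ae_ge0_le_integral => //.
  - by move=> x _; rewrite lee_fin sqr_ge0.
  - by apply: measurable_sqr; apply: measurable_funB => //; exact: Pf2.1.
  - by move=> x _; rewrite adde_ge0// lee_fin sqr_ge0.
  - by apply: emeasurable_funD;
    [exact: measurable_sqr Pu2.1|exact: measurable_sqr Pv2.1].
  apply: filterS2 (ae_markov_opB pi_inv f2 c2)
    (ae_markov_opB pi_inv u2 v2) => x.
  rewrite Pcst => fcx uvx _.
  have -> : (markov_op p f x - c = markov_op p u x - markov_op p v x)%R.
    rewrite -fcx -uvx; congr (markov_op p _ x).
    by apply/funext => y; exact: uvE.
  rewrite -EFinD lee_fin sqrrB.
  by have := mulr_ge0 (Pu0 x) (Pv0 x); lra.
rewrite PfE => /le_trans /(_ (leeD uN vN)).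
move: fcE; rewrite fE.
rewrite -(fineK (sqnorm_fin f2)) -(fineK (sqnorm_fin Pf2)).
rewrite -(fineK (sqnorm_fin u2)) -(fineK (sqnorm_fin v2)).
rewrite -?(EFinM,EFinD) lee_fin => -[fcE] h.
rewrite lee_fin.
have : (0 <= (k ^+ 2 / 4) * c ^+ 2)%R by rewrite mulr_ge0
  ?sqr_ge0// divr_ge0 ?sqr_ge0.
have {}h : (fine (sqnorm pi (markov_op p f)) + c ^+ 2 <=
  (1 - k ^+ 2 / 4) * (fine (sqnorm pi f) + c ^+ 2))%R by rewrite fcE; lra.
lra.
Qed.

End cheeger.

(** * Truncation *)

Section truncation.
Context {R : realType}.

(* [t <= K^(1-y) t^y] when [t > K]. *)
Lemma truncation_pointwise (y K c : R) (h w : \bar R) :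
  (1 < y)%R -> (0 < K)%R -> (K `^ (1 - y) <= c)%R ->
  0 <= h -> 0 <= w <= 1 -> h * w <= K%:E * w + c%:E * h `^ y.
Proof.
move=> y1 K0 Kc h0 /andP[w0 w1].
have c0 : (0 < c)%R by apply: lt_le_trans Kc; rewrite powR_gt0.
have y0 : (y != 0)%R by rewrite gt_eqF// (lt_trans _ y1).
case: h h0 => [t| |]// t0; last first.
  by rewrite poweRyr// gt0_muley ?lte_fin// addey ?leey// gt_eqF//
    (lt_le_trans ltNy0)// mule_ge0// lee_fin ltW.
rewrite lee_fin in t0.
have [tK|Kt] := leP t K.
  rewrite -[leLHS]adde0 leeD ?lee_wpmul2r ?lee_fin//.
  by rewrite mulr_ge0 ?(ltW c0)// powR_ge0.
have tgt0 : (0 < t)%R by exact: lt_trans Kt.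
apply: (@le_trans _ _ t%:E).
  by rewrite -[leRHS]mule1 lee_wpmul2l// lee_fin.
rewrite -[leLHS]add0e leeD ?mule_ge0 ?lee_fin ?(ltW K0)//.
apply: (@le_trans _ _ (K `^ (1 - y) * t `^ y)%R); last first.
  by rewrite ler_wpM2r// powR_ge0.
rewrite -[X in (X * _)%R]mul1r.
have -> : (t `^ y = t * t `^ (y - 1))%R by rewrite mulr_powRB1//
  (lt_trans _ y1).
rewrite mulrCA -[leLHS]mulr1 ler_wpM2l// mul1r -[leLHS](powRr0 K).
have -> : (K `^ 0 = K `^ (1 - y) * K `^ (y - 1))%R.
  rewrite -powRD; first by congr (_ `^ _)%R; ring.
  by apply/implyP => _; rewrite gt_eqF.
rewrite ler_wpM2l ?powR_ge0//.
by rewrite ge0_ler_powR ?nnegrE ?subr_ge0 ?ltW.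
Qed.

(** [K] is chosen before the space and the measure, since it must serve all [p y] and all
    conditional measures at once. The function [g] is kept apart from [|h| * w] because
    [+oo * 0 = 0] can make the product too small; where [|h|] is infinite the norm bound takes
    over. *)
Lemma Lnorm_truncation (q : \bar R) (M eps : R) :
    1 < q -> (0 <= M)%R -> (0 < eps)%R ->
  exists2 K : R, (0 <= K)%R &
  forall (d : measure_display) (T : measurableType d) (mu : probability T R)
    (h w g : T -> \bar R),
    measurable_fun setT h -> measurable_fun setT w -> measurable_fun setT g ->
    (forall x, 0 <= w x <= 1) -> (forall x, 0 <= g x) ->
    (forall x, `|h x| < +oo -> g x <= `|h x| * w x) ->
    'N[mu]_q[h] <= M%:E ->
    \int[mu]_x g x <= K%:E * \int[mu]_x w x + eps%:E.
Proof.
case: q => [y y1 M0 e0|_ M0 e0|//]; last first.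
  (* For [q = +oo], [|h| <= M] almost everywhere and the level [M] cuts off nothing. *)
  exists M => // d T mu h w g mh mw mg w01 g0 gh hM.
  have hMx : {ae mu, forall x, `|h x| <= M%:E}.
    apply/ess_supP; apply: le_trans hM; rewrite unlock.
    rewrite ifT//; apply: (@lt_le_trans _ _ 1) => //.
    by have /eqP := probability_setT mu; rewrite eq_le => /andP[].
  apply: (@le_trans _ _ (\int[mu]_x (M%:E * w x))).
    apply: ae_ge0_le_integral => //.
    - by move=> x _; rewrite mule_ge0 ?lee_fin//; case/andP: (w01 x).
    - exact: measurable_funeM.
    - apply: filterS hMx => x hx _; apply: le_trans (gh x _) _.
        by rewrite (le_lt_trans hx)// ltry.
      by rewrite lee_wpmul2r//; case/andP: (w01 x).
  rewrite ge0_integralZl//; last by move=> x _; case/andP: (w01 x).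
  by rewrite leeDl// lee_fin ltW.
rewrite lte_fin in y1.
have y0 : (0 < y)%R by rewrite (lt_trans _ y1).
(* [K] solves [K^(1-y) = eps / C], so the tail costs at most [(eps / C) M^y <= eps]; the [+ 1] keeps
   [C] positive when [M = 0]. *)
pose C := (M `^ y + 1)%R.
have C0 : (0 < C)%R by rewrite ltr_wpDl ?powR_ge0.
pose K := ((C / eps) `^ (y - 1)^-1)%R.
have K0 : (0 < K)%R by apply: powR_gt0; exact: divr_gt0.
have Kc : (K `^ (1 - y) <= eps / C)%R.
  rewrite -powRrM; have -> : ((y - 1)^-1 * (1 - y) = -1)%R.
    by field; rewrite subr_eq0 gt_eqF.
  by rewrite powR_inv1 ?invf_div// ltW// divr_gt0.
have eC0 : (0 <= eps / C)%R by rewrite ltW// divr_gt0.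
exists K; first exact: ltW.
move=> d T mu h w g mh mw mg w01 g0 gh hM.
have w0 x : 0 <= w x by case/andP: (w01 x).
have mhy : measurable_fun setT (fun x => `|h x| `^ y).
  by apply: (measurableT_comp (measurable_poweR _)); exact: measurableT_comp.
have hy : \int[mu]_x `|h x| `^ y <= (M `^ y)%:E.
  rewrite -poweR_Lnorm ?gt_eqF// -poweR_EFin.
  apply: gt0_ler_poweR => //; first exact: ltW.
  - by rewrite in_itv/= leey Lnorm_ge0.
  - by rewrite in_itv/= leey lee_fin M0.
apply: (@le_trans _ _ (\int[mu]_x (K%:E * w x + (eps / C)%:E * `|h x| `^ y))).
  apply: ge0_le_integral => //.
  - by apply: emeasurable_funD; exact: measurable_funeM.
  - move=> x _; have [hx|] := boolP (`|h x| < +oo).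
      apply: le_trans (gh x hx) _.
      exact: truncation_pointwise.
    rewrite -leNgt leye_eq => /eqP ->; rewrite poweRyr ?gt_eqF//.
    rewrite gt0_muley ?lte_fin ?divr_gt0// addey ?leey// gt_eqF//.
    by rewrite (lt_le_trans ltNy0)// mule_ge0// lee_fin ltW.
rewrite ge0_integralD//; last 4 first.
- by move=> x _; rewrite mule_ge0// lee_fin ltW.
- exact: measurable_funeM.
- by move=> x _; rewrite mule_ge0// poweR_ge0.
- exact: measurable_funeM.
rewrite !ge0_integralZl//; last 2 first.
- by move=> x _; rewrite poweR_ge0.
- by rewrite lee_fin ltW.
apply: leeD2l; apply: (@le_trans _ _ ((eps / C)%:E * (M `^ y)%:E)).
  by rewrite lee_wpmul2l.
rewrite -EFinM lee_fin mulrAC ler_pdivrMr// ler_wpM2l ?(ltW e0)//.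
by rewrite lerDl.
Qed.

End truncation.

(** * Isoperimetric constants *)

(** Needed for [escape_ratio]. Away from zero the extended inverse is the real power -1, whose
    measurability is known. *)
Lemma measurable_inve (d : measure_display) (T : measurableType d)
    (R : realType) (f : T -> \bar R) : measurable_fun setT f ->
  (forall x, 0 <= f x <= 1) -> measurable_fun setT (fun x => (f x)^-1).
Proof.
move=> mf f01.
have fE x : (f x)^-1 = if f x == 0 then +oo else ((fine (f x) `^ (-1))%R)%:E.
  have /andP[] := f01 x; case: (f x) => [t| |]//; rewrite lee_fin => t0 _.
  by rewrite inver eqe; case: ifPn => //= t_neq0; rewrite powR_inv1.
rewrite (_ : (fun x => _) = (fun x => if f x == 0 then +oo else ((fine
  (f x) `^ (-1))%R)%:E)).
  apply: measurable_fun_ifT => //; first exact: measurable_fun_eqe.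
  apply/measurable_EFinP.
  apply: (@measurableT_comp _ _ _ _ _ _ (@powR R ^~ (-1)%R)) => //.
  by apply: measurableT_comp => //; exact: fine_measurable.
by apply/funext => x; exact: fE.
Qed.

Section isoperimetry.
Context {d : measure_display} {T : measurableType d} {R : realType}.
Variables (p : R.-pker T ~> T) (pi : probability T R).
Local Notation Q := (edge_measure p pi).
Local Notation Qr := (rev_edge_measure p pi).

Lemma kernel_iter1E x (B : set T) : measurable B -> kernel_iter p 1 x B = p x B.
Proof.
move=> mB; transitivity (\int[p x]_y (\1_B y)%:E).
  by apply: eq_integral => y _; rewrite /= diracE indicE.
by rewrite integral_indic// setIT.
Qed.

Lemma kernel_iter2E x (B : set T) : measurable B ->
  kernel_iter p 2 x B = \int[p x]_y p y B.
Proof.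
move=> mB; transitivity (\int[p x]_y kernel_iter p 1 y B); first by [].
by apply: eq_integral => y _; rewrite kernel_iter1E.
Qed.

Lemma measurable_kernel_iter n (B : set T) : measurable B ->
  measurable_fun setT (fun x => kernel_iter p n x B).
Proof. by move=> mB; exact: measurable_kernel. Qed.

Lemma kernel_iter_le1 n x (B : set T) : measurable B -> kernel_iter p n x B
  <= 1.
Proof.
move=> mB; apply: le_trans (sprob_kernel_le1 (kernel_iter p n) x).
by apply: le_measure; rewrite ?inE.
Qed.

Lemma flux_le m (B : set T) : measurable B ->
  \int[pi]_(x in B) kernel_iter p m x (~` B) <= pi B.
Proof.
move=> mB; have mBC : measurable (~` B) by exact: measurableC.
rewrite -[leRHS]mul1e -integral_cst//; apply: ge0_le_integral => //.
- exact/measurable_funTS/measurable_kernel_iter.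
- by move=> x _; exact: kernel_iter_le1.
Qed.

Lemma iso_const_le_flux m (k : R) (B : set T) : measurable B ->
  k%:E <= iso_const p pi m ->
  k%:E * (pi B * pi (~` B)) <= \int[pi]_(x in B) kernel_iter p m x (~` B).
Proof.
move=> mB kiso.
have mBC : measurable (~` B) by exact: measurableC.
have [B0|B0] := eqVneq (pi B) 0.
  by rewrite B0 mul0e mule0 integral_ge0.
have [B1|B1] := eqVneq (pi B) 1.
  by rewrite probability_setC// B1 subee// mule0 mule0 integral_ge0.
have pB : 0 < pi B < 1.
  by rewrite lt0e B0 measure_ge0/= lt_neqAle B1/= probability_le1.
have pBC : 0 < pi B * pi (~` B).
  by case/andP: pB => ? ?; rewrite mule_gt0// probability_setC// sube_gt0.
have Bfin : pi B * pi (~` B) \is a fin_num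
  by rewrite fin_numM// fin_num_measure.
have : k%:E <= iso_ratio p pi m B.
  by apply: le_trans kiso _; apply: ereal_inf_lbound; exists B.
rewrite /iso_ratio -(fineK Bfin) inver gt_eqF ?fine_gt0 ?pBC ?ltey_eq ?Bfin//.
have fpos : (0 < fine (pi B * pi (~` B)))%R
  by rewrite fine_gt0// pBC ltey_eq Bfin.
by rewrite muleC lee_pdivlMr// muleC.
Qed.

Lemma flux_le_iso_ratio m (c : R) (B : set T) : measurable B -> 0 < pi B < 1 ->
  c%:E * (pi B * pi (~` B)) <= \int[pi]_(x in B) kernel_iter p m x (~` B) ->
  c%:E <= iso_ratio p pi m B.
Proof.
move=> mB pB.
have mBC : measurable (~` B) by exact: measurableC.
have pBC : 0 < pi B * pi (~` B).
  by case/andP: pB => ? ?; rewrite mule_gt0// probability_setC// sube_gt0.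
have Bfin : pi B * pi (~` B) \is a fin_num
  by rewrite fin_numM// fin_num_measure.
have fpos : (0 < fine (pi B * pi (~` B)))%R
  by rewrite fine_gt0// pBC ltey_eq Bfin.
rewrite /iso_ratio -(fineK Bfin) inver gt_eqF//.
by rewrite [X in _ -> _ <= X]muleC lee_pdivlMr// muleC.
Qed.

Lemma Lnorm_kernel_prob (q : \bar R) x (f : T -> \bar R) :
  'N[kernel_prob p x]_q[f] = 'N[p x]_q[f].
Proof. by rewrite !unlock. Qed.

Hypothesis pi_inv : invariant_prob p pi.

(** * From [k_2] to the spread, through the density of [Q] *)

Section very_weak_reversible.
Hypotheses (Q_dom : Q `<< Qr) (p_vwr : very_weak_reversible1 p pi).

Let h : T * T -> \bar R := edge_density p pi.

Let mh : measurable_fun setT h.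
Proof.
apply: (measurable_int Qr).
exact: (@Radon_Nikodym_integrable _ _ _ (charge_of_finite_measure Q) Qr Q_dom).
Qed.

(** The chosen Radon-Nikodym version is not known to be nonnegative pointwise; passing to [|h|]
    costs only an inequality and matches the L^q norm. *)
Let edge_integral_le (f : T * T -> \bar R) : measurable_fun setT f ->
  (forall z, 0 <= f z <= 1) ->
  \int[Q]_z f z <= \int[Qr]_z (f z * `|h z|).
Proof.
move=> mf f01; have f0 z : 0 <= f z by case/andP: (f01 z).
have fi : Q.-integrable setT f.
  apply: (@le_integrable _ _ _ _ _ measurableT _ (cst 1)) => //.
  - by move=> z _ /=; rewrite gee0_abs// normr1; case/andP: (f01 z).
  - exact: finite_measure_integrable_cst.
rewrite -(Radon_Nikodym_change_of_variables Q_dom measurableT fi).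
apply: le_trans (lee_abs _) _.
apply: le_trans (le_abse_integral _ _ _) _ => //.
  exact: emeasurable_funM.
apply: ge0_le_integral => //.
- by apply: measurableT_comp => //; exact: emeasurable_funM.
- by apply: emeasurable_funM => //; exact: measurableT_comp.
- by move=> z _; rewrite abseM gee0_abs.
Qed.

Lemma flux2_le_spread (eps : R) : (0 < eps)%R ->
  exists2 K : R, (0 <= K)%R & forall B, measurable B ->
    \int[pi]_(x in ~` B) kernel_iter p 2 x B <=
    K%:E * spread p pi B + eps%:E * pi B.
Proof.
move=> e0; have [q q1] := p_vwr.
set S := ess_sup _ _ => Slty.
have S0 : 0 <= S.
  apply: ess_sup_gee; last by apply: nearW => y; exact: Lnorm_ge0.
  apply: (@lt_le_trans _ _ 1) => //.
  by have /eqP := probability_setT pi; rewrite eq_le => /andP[].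
have SE : S = (fine S)%:E by rewrite fineK// ge0_fin_numE.
have [K K0 HK] := Lnorm_truncation q1 (fine_ge0 S0) e0.
exists K => // B mB; have mBC : measurable (~` B) by exact: measurableC.
pose f (z : T * T) : \bar R := (\1_(~` B) z.1)%:E * p z.2 B.
have mf : measurable_fun setT f.
  apply: emeasurable_funM.
  - by apply/measurable_EFinP; apply: measurableT_comp => //;
    exact: measurable_indic.
  - exact: measurableT_comp (measurable_kernel p B mB) _.
have f01 z : 0 <= f z <= 1.
  rewrite /f indicE; case: (_ \in _); rewrite ?mul1e ?mul0e ?lee01 ?lexx//.
  by rewrite measure_ge0 kernel_le1.
have f0 z : 0 <= f z by case/andP: (f01 z).
have -> : \int[pi]_(x in ~` B) kernel_iter p 2 x B = \int[Q]_z f z.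
  rewrite ge0_edge_integral// integral_mkcond; apply: eq_integral => x _.
  rewrite patchE /f/= indicE; case: ifPn => xB.
    by rewrite kernel_iter2E//; apply: eq_integral => y _; rewrite mul1e.
  by rewrite integral0_eq// => y _; rewrite mul0e.
apply: le_trans (edge_integral_le mf f01) _.
have mfh : measurable_fun setT (fun z => f z * `|h z|).
  by apply: emeasurable_funM => //; exact: measurableT_comp.
rewrite ge0_rev_edge_integral//; last by move=> z; rewrite mule_ge0.
have mhy y : measurable_fun setT (h \o pair^~ y).
  by apply: measurableT_comp => //; exact: pair2_measurable.
have mahy y : measurable_fun setT (fun x => `|h (x, y)|).
  exact: measurableT_comp (mhy y).
have mpB := measurable_kernel p B mB.
have mpBC := measurable_kernel p (~` B) mBC.
have mind : measurable_fun setT (fun x => (\1_(~` B) x)%:E : \bar R).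
  by apply/measurable_EFinP; exact: measurable_indic.
have ind01 x : 0 <= ((\1_(~` B) x)%:E : \bar R) <= 1.
  by rewrite indicE; case: (_ \in _); rewrite ?lee01 ?lexx.
have hbound : {ae pi, forall y,
    \int[p y]_x (`|h (x, y)| * (\1_(~` B) x)%:E) <= K%:E * p y (~` B) + eps%:E}.
  have : {ae pi, forall y, 'N[p y]_q[h \o pair^~ y] <= (fine S)%:E}.
    by rewrite -SE; exact: ess_sup_ge.
  apply: filterS => y; rewrite -Lnorm_kernel_prob => hy.
  have := HK _ _ (kernel_prob p y) (h \o pair^~ y) (fun x => (\1_(~` B) x)%:E)
    (fun x => `|h (x, y)| * (\1_(~` B) x)%:E) (mhy y) mind _ ind01 _ _ hy.
  by rewrite integral_indic// setIT; apply => //; exact: emeasurable_funM.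
apply: (@le_trans _ _ (\int[pi]_y (p y B * (K%:E * p y (~` B) + eps%:E)))).
  apply: ae_ge0_le_integral => //.
  - by move=> y _; apply: integral_ge0 => x _; rewrite mule_ge0.
  - have mfh' : measurable_fun setT (fun z : T * T => f (z.2, z.1) * `|h
    (z.2, z.1)|).
      apply: (measurableT_comp mfh).
      exact: measurable_swap.
    by apply: (measurable_kernel_section p mfh') => z; rewrite mule_ge0.
  - by move=> y _; rewrite mule_ge0// adde_ge0// ?mule_ge0 ?lee_fin// ltW.
  - by apply: emeasurable_funM => //; apply: emeasurable_funD => //;
    exact: measurable_funeM.
  - apply: filterS hbound => y hy _; apply: le_trans (lee_wpmul2l _ hy) => //.
    rewrite -ge0_integralZl//; last exact: emeasurable_funM.
    rewrite le_eqVlt; apply/orP; left; apply/eqP; apply: eq_integral => x _.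
    by rewrite /f/= (muleC _ (p y B)) -muleA (muleC `|_|).
have eps0 : 0 <= eps%:E by rewrite lee_fin ltW.
have -> : \int[pi]_y (p y B * (K%:E * p y (~` B) + eps%:E)) =
    \int[pi]_y (K%:E * (p y B * p y (~` B)) + eps%:E * p y B).
  apply: eq_integral => y _; rewrite ge0_muleDr ?mule_ge0//.
  by rewrite muleCA (muleC eps%:E).
rewrite ge0_integralD//; last 4 first.
- by move=> y _; rewrite !mule_ge0.
- by apply: measurable_funeM; exact: measurable_spread_fun.
- by move=> y _; rewrite mule_ge0.
- exact: measurable_funeM.
by rewrite !ge0_integralZl ?pi_inv//; exact: measurable_spread_fun.
Qed.

Lemma iso_const2_spread : 0 < iso_const p pi 2 ->
  exists2 k : R, (0 < k)%R & forall B, measurable B -> pi B <= 2^-1%:E ->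
    k%:E * pi B <= spread p pi B.
Proof.
move=> k2.
have [k k0 kk2] : exists2 k : R, (0 < k)%R & k%:E <= iso_const p pi 2.
  case: (iso_const p pi 2) k2 => [r|_|]//; first by rewrite lte_fin => r0;
    exists r.
  by exists 1%R; rewrite ?leey.
have k4 : (0 < k / 4)%R by rewrite divr_gt0.
have [K K0 HK] := flux2_le_spread k4.
have K1 : (0 < K + 1)%R by rewrite ltr_wpDl.
(* As [pi (~] B) >= 1/2[, the flow out of]~[B] is at least [k/2 pi B], so
   [k/4 pi B <= K * spread B]. [K + 1] replaces [K], which may be 0. *)
exists (k / 4 / (K + 1))%R; first by rewrite divr_gt0.
move=> B mB B2; have mBC : measurable (~` B) by exact: measurableC.
have := iso_const_le_flux mBC kk2; rewrite setCK => /le_trans /(_ (HK _ mB)).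
have spread_fin : spread p pi B \is a fin_num.
  rewrite ge0_fin_numE; last by apply: integral_ge0 => x _; rewrite mule_ge0.
  apply: (@le_lt_trans _ _ 1); last by rewrite ltry.
  rewrite -(probability_integral_cst pi 1); apply: ge0_le_integral => //.
  - exact: measurable_spread_fun.
  - by move=> x _; rewrite -[leRHS]mule1 lee_pmul// kernel_le1.
have spread0 : 0 <= spread p pi B by apply: integral_ge0 => x _;
  rewrite mule_ge0.
have Bfin : pi B \is a fin_num by exact: fin_num_measure.
have B0 : 0 <= pi B by [].
move: spread0 B0 B2;
  rewrite probability_setC// -(fineK spread_fin) -(fineK Bfin).
move: (fine (spread _ _ _)) (fine (pi B)) => s b.
rewrite -?(EFinM,EFinD,EFinB) !lee_fin => s0 b0 b2 H.
have : (0 <= k * b * (2^-1 - b))%R.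
  by rewrite (mulr_ge0 (mulr_ge0 (ltW k0) b0))// subr_ge0.
by move=> ?; rewrite mulrAC ler_pdivrMr//; lra.
Qed.

End very_weak_reversible.

(** * From [k_1] to [k_2] along the minimizing sequence *)

Lemma ge0_cond_prob_integral (B : set T) (mB : measurable B) (f : T -> \bar R) :
  0 < pi B -> measurable_fun setT f -> (forall x, 0 <= f x) ->
  pi B * \int[cond_prob pi mB]_(x in B) f x = \int[pi]_(x in B) f x.
Proof.
move=> B0 mf f0.
have Bfin : pi B \is a fin_num by exact: fin_num_measure.
have fineB0 : (0 <= fine (pi B))%R by rewrite fine_ge0.
rewrite -{1}(fineK Bfin) -[X in X%:E * _]/((NngNum fineB0)%:num).
rewrite -ge0_integral_mscale//; last exact: measurable_funTS.
apply: eq_measure_integral => D mD DB.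
transitivity ((fine (pi B))%:E * cond_prob pi mB D); first by [].
by rewrite cond_probE// fineK// (setIidr DB) muleCA divee ?mule1// gt_eqF.
Qed.

(** Truncation under the conditional measure with [h] the escape ratio and [w] the two-step exit
    probability, so that [h * w] is the one-step exit probability wherever [h] is finite. *)
Lemma flux1_le_flux2 (r : \bar R) (M eps : R) :
    1 < r -> (0 <= M)%R -> (0 < eps)%R ->
  exists2 K : R, (0 <= K)%R & forall (B : set T)
    (mB : measurable B), 0 < pi B ->
    'N[cond_prob pi mB]_r[(fun x => (\1_B x)%:E * escape_ratio p B x)]
      <= M%:E ->
    \int[pi]_(x in B) p x (~` B) <=
    K%:E * \int[pi]_(x in B) kernel_iter p 2 x (~` B) + eps%:E * pi B.
Proof.
move=> r1 M0 e0; have [K K0 HK] := Lnorm_truncation r1 M0 e0.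
exists K => // B mB B0; have mBC : measurable (~` B) by exact: measurableC.
set h := fun x => _ => hM.
pose w := (fun x => kernel_iter p 2 x (~` B)) \_ B.
pose g := (fun x => p x (~` B)) \_ B.
have mp2 := measurable_kernel_iter 2 mBC.
have mp := measurable_kernel p (~` B) mBC.
have mw : measurable_fun setT w by apply/(measurable_restrictT _ mB);
  exact: measurable_funTS.
have mg : measurable_fun setT g by apply/(measurable_restrictT _ mB);
  exact: measurable_funTS.
have mh : measurable_fun setT h.
  apply: emeasurable_funM; first by apply/measurable_EFinP;
    exact: measurable_indic.
  apply: emeasurable_funM => //; apply: measurable_inve => // x.
  by rewrite measure_ge0 kernel_iter_le1.
have w01 x : 0 <= w x <= 1.
  rewrite /w patchE; case: ifPn => _; last by rewrite lexx lee01.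
  by rewrite measure_ge0 kernel_iter_le1.
have g0 x : 0 <= g x by rewrite /g patchE; case: ifPn.
have gh x : `|h x| < +oo -> g x <= `|h x| * w x.
  rewrite /g /w !patchE; case: ifPn => xB; last by rewrite mule0.
  rewrite /h indicE xB mul1e /escape_ratio.
  have p2fin : kernel_iter p 2 x (~` B) \is a fin_num.
    rewrite ge0_fin_numE//; apply: le_lt_trans (kernel_iter_le1 _ _ _) _ => //.
    by rewrite ltry.
  have pfin : p x (~` B) \is a fin_num by exact: kernel_fin_num.
  have p0 : 0 <= p x (~` B) by [].
  have p20 : 0 <= kernel_iter p 2 x (~` B) by [].
  move: p0 p20; rewrite -(fineK p2fin) -(fineK pfin).
  move: (fine _) (fine _) => a b; rewrite !lee_fin => b0 a0.
  (* Here [a] is the two-step and [b] the one-step exit probability. If [a = 0 < b] the ratio is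
     [+oo], against the finiteness assumption; if both vanish, [0 * +oo = 0] suffices. *)
  rewrite inver; case: eqVneq => [->|a_neq0].
    have [->|b_neq0] := eqVneq b 0%R; first by rewrite mul0e abse0 mul0e.
    by rewrite gt0_muley ?lte_fin ?lt0r ?b_neq0.
  rewrite gee0_abs; last by rewrite mule_ge0 ?lee_fin ?invr_ge0.
  by move=> _; rewrite -!EFinM mulfVK.
have := HK _ _ (cond_prob pi mB) h w g mh mw mg w01 g0 gh hM.
rewrite -!integral_mkcond.
have pBfin : pi B \is a fin_num by exact: fin_num_measure.
have pB0 : 0 <= pi B by [].
move=> /(lee_wpmul2l pB0); rewrite ge0_cond_prob_integral// => /le_trans; apply.
rewrite [leLHS]ge0_muleDr; last 2 first.
- by rewrite mule_ge0 ?lee_fin// integral_ge0.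
- by rewrite lee_fin ltW.
by rewrite muleCA ge0_cond_prob_integral// (muleC (pi B) eps%:E).
Qed.

(** The escape ratio is controlled on the sets [A n] alone, so only their two-step ratios are
    bounded below, by a constant free of [n]; the minimizing property carries the bound to the
    infimum. *)
Lemma iso_const1_iso_const2 (r : \bar R) (A : (set T)^nat)
    (mA : forall n, measurable (A n)) :
  1 < r -> (forall n, 0 < pi (A n) <= (2^-1)%:E) ->
  iso_ratio p pi 2 (A n) @[n --> \oo] --> iso_const p pi 2 ->
  ereal_sup (range (fun n => 'N[cond_prob pi (mA n)]_r[
        (fun x => (\1_(A n) x)%:E * escape_ratio p (A n) x)])) < +oo ->
  0 < iso_const p pi 1 -> 0 < iso_const p pi 2.
Proof.
move=> r1 piA k2A; set S := ereal_sup _ => Slty k1.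
have SA n : 'N[cond_prob pi (mA n)]_r[
    (fun x => (\1_(A n) x)%:E * escape_ratio p (A n) x)] <= S.
  by apply: ereal_sup_ubound; exists n.
have S0 : 0 <= S by apply: le_trans (SA 0%N); exact: Lnorm_ge0.
have SE : S = (fine S)%:E by rewrite fineK// ge0_fin_numE.
have [k k0 kk1] : exists2 k : R, (0 < k)%R & k%:E <= iso_const p pi 1.
  case: (iso_const p pi 1) k1 => [s|_|]//; first by rewrite lte_fin => s0;
    exists s.
  by exists 1%R; rewrite ?leey.
have k4 : (0 < k / 4)%R by rewrite divr_gt0.
have [K K0 HK] := flux1_le_flux2 r1 (fine_ge0 S0) k4.
have K1 : (0 < K + 1)%R by rewrite ltr_wpDl.
pose c := (k / 4 / (K + 1))%R.
have c0 : (0 < c)%R by rewrite divr_gt0.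
suff : c%:E <= iso_const p pi 2 by apply: lt_le_trans; rewrite lte_fin.
rewrite -(cvg_lim _ k2A)//; apply: lime_ge; first exact: cvgP k2A.
apply: nearW => n; have /andP[A0 A2] := piA n.
have mAC : measurable (~` A n) by exact: measurableC.
apply: flux_le_iso_ratio => //.
  by rewrite A0 (le_lt_trans A2)// lte_fin invf_lt1// ltr1n.
have := iso_const_le_flux (mA n) kk1.
have -> : \int[pi]_(x in A n) kernel_iter p 1 x (~` A n) =
    \int[pi]_(x in A n) p x (~` A n).
  by apply: eq_integral => x _; rewrite kernel_iter1E.
have := HK _ (mA n) A0; rewrite -SE => /(_ (SA n)) flux12.
move=> /le_trans /(_ flux12).
have Ffin : \int[pi]_(x in A n) kernel_iter p 2 x (~` A n) \is a fin_num.
  rewrite ge0_fin_numE ?integral_ge0//; apply: le_lt_trans (flux_le _ (mA n)) _.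
  by rewrite ltey_eq fin_num_measure.
have F0 : 0 <= \int[pi]_(x in A n) kernel_iter p 2 x (~` A n).
  by rewrite integral_ge0.
have Afin : pi (A n) \is a fin_num by exact: fin_num_measure.
move: F0 A0 A2; rewrite probability_setC// -(fineK Ffin) -(fineK Afin).
move: (fine (integral _ _ _)) (fine (pi _)) => s b.
rewrite -?(EFinM,EFinD,EFinB) !lee_fin lte_fin => s0 b0 b2 H.
have : (0 <= k * b * (2^-1 - b))%R.
  by rewrite (mulr_ge0 (mulr_ge0 (ltW k0) (ltW b0)))// subr_ge0.
move=> ?; rewrite /c.
have : (0 <= k * b * b)%R by rewrite (mulr_ge0 (mulr_ge0 (ltW k0) (ltW b0))
  (ltW b0)).
move=> ?; rewrite mulrAC ler_pdivrMr//; lra.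
Qed.

End isoperimetry.

(** * Existence of the limit *)

Section fekete.
Context {R : realType}.
Variable r : nat -> R.
Hypotheses (r_ge0 : forall n, (0 <= r n)%R) (r_le1 : forall n, (r n <= 1)%R).
Hypothesis r_sub : forall m n, (0 < m)%N -> (0 < n)%N ->
  (r (m + n) ^+ (m + n) <= r m ^+ m * r n ^+ n)%R.

(** The remainder [s] is absorbed by [r <= 1]. Subadditivity is assumed for positive indices only,
    so [q * m + s = 0] is treated apart. *)
Let fekete_mul m q s : (0 < m)%N ->
  (r (q * m + s) ^+ (q * m + s) <= (r m ^+ m) ^+ q)%R.
Proof.
move=> m0; elim: q => [|q ih]; first by rewrite expr0 exprn_ile1.
rewrite exprS mulSn -addnA; have [|ne0] := posnP (q * m + s).
  move/eqP; rewrite addn_eq0 muln_eq0 => /andP[/orP[]/eqP qm /eqP s0].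
    by rewrite qm s0 mul0n !addn0 expr0 mulr1.
  by rewrite qm in m0.
by apply: le_trans (r_sub m0 ne0) _; rewrite ler_wpM2l ?exprn_ge0.
Qed.

(** The multiplicative form, without logarithms, lets [r n] vanish. *)
Lemma fekete : r n @[n --> \oo] --> inf [set r n | n in [set n | (0 < n)%N]].
Proof.
set S := [set r n | n in _]; set L := inf S.
have S0 : S !=set0 by exists (r 1%N), 1%N.
have Slb : has_lbound S by exists 0%R => _ [n _ <-].
have L0 : (0 <= L)%R by apply: lb_le_inf => // _ [n _ <-].
have Lr n : (0 < n)%N -> (L <= r n)%R by move=> n0; apply: inf_lbound => //;
  exists n.
apply/cvgrPdist_le => /= e e0.
have e20 : (0 < e / 2)%R by rewrite divr_gt0.
have [_ [m m0 <-] rm] := inf_adherent e20 (conj S0 Slb).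
rewrite -/L in rm.
(* [c] dominates [r m], is positive even if [L = 0], and is at most 1, so that lowering an exponent
   increases the power. *)
pose c := Num.min 1%R (L + e / 2)%R.
have c0 : (0 < c)%R by rewrite lt_min ltr01/= ltr_wpDl.
have c1 : (c <= 1)%R by rewrite ge_min lexx.
have rmc : (r m <= c)%R by rewrite le_min r_le1 ltW.
have cL : (c <= L + e / 2)%R by rewrite ge_min lexx orbT.
(* Bernoulli: [(1 + h)^n >= 1 + n h] eventually exceeds [c^-m]. *)
pose h := (e / 2 / c)%R.
have h0 : (0 < h)%R by rewrite divr_gt0.
near=> n.
have n0 : (0 < n)%N by near: n; exists 1%N.
have mn : (m <= n)%N by near: n; exists m.
rewrite distrC ger0_norm ?subr_ge0 ?Lr// lerBlDl.
rewrite -(@ler_pXn2r _ n)// ?nnegrE ?addr_ge0// ?(ltW e0)//.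
have -> : n = (n %/ m * m + n %% m)%N by rewrite -divn_eq.
apply: le_trans (fekete_mul _ _ m0) _; rewrite -divn_eq.
rewrite -exprM mulnC.
apply: (@le_trans _ _ (c ^+ (n %/ m * m))%R).
  by rewrite lerXn2r ?nnegrE ?(ltW c0).
apply: (@le_trans _ _ (c ^+ (n - m))%R).
  rewrite ler_wiXn2l ?(ltW c0)//.
  rewrite leq_subLR {1}(divn_eq n m) addnC leq_add2r ltnW// ltn_mod//.
apply: (@le_trans _ _ ((c + e / 2) ^+ n)%R); last first.
  rewrite lerXn2r ?nnegrE ?addr_ge0 ?(ltW c0) ?(ltW e0) ?(ltW e20)//.
  by lra.
have -> : (c + e / 2 = c * (1 + h))%R by rewrite /h; field; rewrite gt_eqF.
rewrite exprMn -(subnK mn) exprD subnK// -mulrA ler_peMr ?exprn_ge0 ?(ltW c0)//.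
apply: (@le_trans _ _ (c ^+ m * (1 + h *+ n))%R); last first.
  rewrite ler_wpM2l ?exprn_ge0 ?(ltW c0)//.
  elim: (n) => [|k ih]; first by rewrite mulr0n addr0 expr0.
  rewrite exprSr; apply: (@le_trans _ _ ((1 + h *+ k) * (1 + h))%R); last first.
    by rewrite ler_wpM2r// addr_ge0// ltW.
  have : (0 <= h *+ k * h)%R by rewrite mulr_ge0 ?mulrn_wge0 ?(ltW h0).
  by rewrite mulrSr; lra.
rewrite -ler_pdivrMl ?exprn_gt0// mulr1 -lerBlDl -mulr_natr -ler_pdivrMl//.
near: n; exact: nbhs_infty_ger.
Unshelve. all: by end_near.
Qed.

End fekete.

(** * The spectral gap in terms of squared norms *)

Section L2_01.
Context {d : measure_display} {T : measurableType d} {R : realType}.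
Variables (p : R.-pker T ~> T) (pi : probability T R).

Lemma Lnorm2E (f : T -> R) :
  'N[pi]_2%:E[EFin \o f] = sqnorm pi f `^ 2^-1.
Proof.
rewrite unlock; congr (_ `^ _); apply: eq_integral => x _ /=.
by rewrite powR_mulrn// real_normK// num_real.
Qed.

Lemma L2_01P (f : T -> R) : L2_01 pi f <->
  [/\ square_integrable pi f, \int[pi]_x (f x)%:E = 0 & sqnorm pi f = 1].
Proof.
split=> [[fL f0 f1]|[[mf _] f0 f1]].
  split => //; split; first exact: set_mem (sub_Lfun_mfun fL).
  by rewrite /sqnorm f1 ltry.
split => //; apply/andP; split; first by rewrite inE.
by rewrite inE/= /finite_norm Lnorm2E f1 poweR1r ltry.
Qed.

Lemma root_sqrt_le (s c : R) n : (0 < n)%N -> (0 <= s)%R -> (0 <= c)%R ->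
  (s%:E `^ 2^-1 `^ n%:R^-1 <= c%:E) = (s <= c ^+ (n * 2))%R.
Proof.
move=> n0 s0 c0; rewrite -poweRrM poweR_EFin lee_fin.
have n20 : ((n * 2)%:R != 0 :> R)%R
  by rewrite pnatr_eq0 muln_eq0 negb_or/= andbT -lt0n.
have -> : (2^-1 * n%:R^-1 = (n * 2)%:R^-1 :> R)%R by rewrite natrM invfM mulrC.
rewrite -(@ler_pXn2r _ (n * 2)) ?nnegrE ?powR_ge0//;
  last by rewrite muln_gt0 n0.
by rewrite -(powR_mulrn _ (powR_ge0 _ _)) -powRrM mulVf// powRr1.
Qed.

Lemma sqnorm_pow_le (f : T -> R) (c : R) n : (0 < n)%N -> (0 <= c)%R ->
  square_integrable pi f ->
  ('N[pi]_2%:E[EFin \o f] `^ n%:R^-1 <= c%:E) =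
  (sqnorm pi f <= (c ^+ (n * 2))%:E).
Proof.
move=> n0 c0 f2; rewrite Lnorm2E -(fineK (sqnorm_fin f2)).
by rewrite root_sqrt_le ?lee_fin// fine_ge0// sqnorm_ge0.
Qed.

Hypothesis pi_inv : invariant_prob p pi.

Lemma spectral_gap_seq_ge0 n : L2_01 pi !=set0 -> 0 <= spectral_gap_seq p pi n.
Proof.
move=> [f Lf];
  apply: (@le_trans _ _ ('N[pi]_2%:E[EFin \o iter n
    (markov_op p) f] `^ n%:R^-1)).
  exact: poweR_ge0.
by apply: ereal_sup_ubound; exists f.
Qed.

(** Removes the n-th root and the square root together, hence the exponent [n * 2]. *)
Lemma spectral_gap_seqP (c : R) n : (0 < n)%N -> (0 <= c)%R ->
  spectral_gap_seq p pi n <= c%:E <->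
  (forall f, L2_01 pi f ->
    sqnorm pi (iter n (markov_op p) f) <= (c ^+ (n * 2))%:E).
Proof.
move=> n0 c0; split=> [nc f Lf|H].
  have /L2_01P[f2 _ _] := Lf.
  rewrite -sqnorm_pow_le//; last exact: square_integrable_iter.
  by apply: le_trans nc; apply: ereal_sup_ubound; exists f.
apply: ge_ereal_sup => _ [f Lf <-]; have /L2_01P[f2 _ _] := Lf.
by rewrite sqnorm_pow_le//; [exact: H|exact: square_integrable_iter].
Qed.

Lemma integral_iter_markov_op n (f : T -> R) : square_integrable pi f ->
  \int[pi]_x (iter n (markov_op p) f x)%:E = \int[pi]_x (f x)%:E.
Proof.
move=> f2; elim: n => //= n ih.
by rewrite integral_markov_op//; exact: square_integrable_iter.
Qed.

(* By homogeneity the bound on the unit sphere extends to all centered [f]. *)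
Lemma sqnorm_iter_le (C : R) n : (0 <= C)%R ->
  (forall f, L2_01 pi f -> sqnorm pi (iter n (markov_op p) f) <= C%:E) ->
  forall f, square_integrable pi f -> \int[pi]_x (f x)%:E = 0 ->
    sqnorm pi (iter n (markov_op p) f) <= C%:E * sqnorm pi f.
Proof.
move=> C0 H f f2 f0; have [mf _] := f2.
have [s0|s_neq0] := eqVneq (sqnorm pi f) 0.
  rewrite s0 mule0; elim: n {H} => [|n ih] /=; first by rewrite s0.
  by apply: le_trans ih; apply: sqnorm_markov_op => //;
    exact: square_integrable_iter.
have ffin := sqnorm_fin f2.
pose s := fine (sqnorm pi f).
have s_gt0 : (0 < s)%R.
  by rewrite fine_gt0// lt0e s_neq0 sqnorm_ge0/= ltey_eq ffin.
pose c := (Num.sqrt s)^-1%R.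
have c0 : (0 <= c)%R by rewrite invr_ge0 sqrtr_ge0.
have c2 : (c ^+ 2 = s^-1)%R by rewrite exprVn sqr_sqrtr// ltW.
have /H : L2_01 pi (fun x => c * f x)%R.
  apply/L2_01P; split; first exact: square_integrableZ.
  - under eq_integral do rewrite EFinM.
    by rewrite integralZl ?f0 ?mule0//; exact: square_integrable_integrable.
  - by rewrite sqnormZ// c2 -(fineK ffin) -EFinM mulVf// gt_eqF.
rewrite iter_markov_opZ// sqnormZ; last exact: measurable_iter_markov_op.
rewrite c2 -(fineK ffin) -/s muleC lee_pdivrMr//.
Qed.

Lemma L2_spectral_gap_of_contraction (c : R) : (0 <= c < 1)%R ->
  L2_01 pi !=set0 ->
  (forall f, square_integrable pi f -> \int[pi]_x (f x)%:E = 0 ->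
    sqnorm pi (markov_op p f) <= (c ^+ 2)%:E * sqnorm pi f) ->
  L2_spectral_gap p pi.
Proof.
move=> /andP[c0 c1] L0 Hc.
have iterc n f : L2_01 pi f ->
    sqnorm pi (iter n (markov_op p) f) <= (c ^+ (n * 2))%:E.
  move=> /L2_01P[f2 f0 f1]; elim: n => [|n ih] /=; first by rewrite f1 expr0.
  apply: le_trans (Hc _ _ _) _.
  - exact: square_integrable_iter.
  - by rewrite integral_iter_markov_op.
  - have -> : (c ^+ (n.+1 * 2) = c ^+ 2 * c ^+ (n * 2))%R
    by rewrite mulSn exprD.
    by rewrite [leRHS]EFinM lee_wpmul2l// lee_fin sqr_ge0.
have seqc n : (0 < n)%N -> spectral_gap_seq p pi n <= c%:E.
  by move=> n0; apply/spectral_gap_seqP => // f; exact: iterc.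
(* At index 0 the exponent [0^-1] is 0 and the sequence equals 1, which would break [r n <= c]; the
   limit ignores this value. *)
pose r n := if n is 0%N then 0%R else fine (spectral_gap_seq p pi n).
have rE n : (0 < n)%N -> spectral_gap_seq p pi n = (r n)%:E.
  case: n => // n _; rewrite /r fineK// ge0_fin_numE ?spectral_gap_seq_ge0//.
  by apply: le_lt_trans (seqc _ _) _ => //; rewrite ltry.
have r0 n : (0 <= r n)%R by case: n => // n;
  rewrite fine_ge0// spectral_gap_seq_ge0.
have rc n : (r n <= c)%R.
  by case: n => // n; rewrite -lee_fin -rE// seqc.
have r1 n : (r n <= 1)%R by rewrite (le_trans (rc n))// ltW.
have rf n f : (0 < n)%N -> L2_01 pi f ->
    sqnorm pi (iter n (markov_op p) f) <= (r n ^+ (n * 2))%:E.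
  by move=> n0; apply: (spectral_gap_seqP n0 (r0 n)).1; rewrite rE.
have rsub m n : (0 < m)%N -> (0 < n)%N ->
    (r (m + n) ^+ (m + n) <= r m ^+ m * r n ^+ n)%R.
  move=> m0 n0; have mn0 : (0 < m + n)%N by rewrite addn_gt0 m0.
  set a := (r m ^+ m * r n ^+ n)%R.
  have a0 : (0 <= a)%R by rewrite mulr_ge0 ?exprn_ge0.
  (* With [b] the root of the target, submultiplicativity becomes a bound on [spectral_gap_seq] at
     [m + n], proved by applying the [m]-step bound to the centered function [P^n f]. *)
  pose b := (a `^ (m + n)%:R^-1)%R.
  have bE : (b ^+ (m + n) = a)%R.
    by rewrite -powR_mulrn ?powR_ge0// -powRrM mulVf ?powRr1// pnatr_eq0 -lt0n.
  rewrite -bE lerXn2r ?nnegrE ?powR_ge0// -lee_fin -rE//.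
  apply/spectral_gap_seqP => //; first exact: powR_ge0.
  move=> f Lf; have /L2_01P[f2 f0 f1] := Lf.
  rewrite iterD exprM bE.
  have Cn0 : (0 <= r m ^+ (m * 2))%R by rewrite exprn_ge0.
  apply: le_trans (sqnorm_iter_le Cn0 (fun f => @rf m f m0) _ _) _.
  - exact: square_integrable_iter.
  - by rewrite integral_iter_markov_op.
  - by rewrite exprMn -!exprM [leRHS]EFinM lee_wpmul2l ?lee_fin//; exact: rf.
exists (inf [set r n | n in [set n | (0 < n)%N]])%:E.
  apply: (@cvg_trans _ ((r n)%:E @[n --> \oo])); last first.
    by apply: cvg_EFin; [exact: nearW|exact: fekete].
  apply: near_eq_cvg; near=> n.
  by rewrite rE//; near: n; exists 1%N.
rewrite lte_fin (le_lt_trans _ c1)// (le_trans _ (rc 1%N))//.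
by apply: inf_lbound; [exists 0%R => _ [n _ <-]|exists 1%N].
Unshelve. all: by end_near.
Qed.

End L2_01.

(** * From the spectral gap to isoperimetry *)

Section converse.
Context {d : measure_display} {T : measurableType d} {R : realType}.
Variables (p : R.-pker T ~> T) (pi : probability T R).

(** Young's inequality, used in place of the triangle inequality; the difference of the integrands
    is [t (f - g/t)^2]. *)
Lemma sqnormD_le (t : R) (f g : T -> R) : (0 < t)%R ->
  measurable_fun setT f -> measurable_fun setT g ->
  sqnorm pi (fun x => f x + g x)%R <=
  (1 + t)%:E * sqnorm pi f + (1 + t^-1)%:E * sqnorm pi g.
Proof.
move=> t0 mf mg; have tV0 : (0 < t^-1)%R by rewrite invr_gt0.
have mf2 := measurable_sqr mf; have mg2 := measurable_sqr mg.
have c1 : 0 <= (1 + t)%:E by rewrite lee_fin addr_ge0// ltW.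
have c2 : 0 <= (1 + t^-1)%:E by rewrite lee_fin addr_ge0// ltW.
have f0 x : 0 <= ((f x) ^+ 2)%:E by rewrite lee_fin sqr_ge0.
have g0 x : 0 <= ((g x) ^+ 2)%:E by rewrite lee_fin sqr_ge0.
rewrite /sqnorm -!ge0_integralZl// -ge0_integralD//; last 4 first.
- by move=> x _; rewrite mule_ge0.
- exact: measurable_funeM.
- by move=> x _; rewrite mule_ge0.
- exact: measurable_funeM.
apply: ge0_le_integral => //.
- by move=> x _; rewrite lee_fin sqr_ge0.
- by apply: measurable_sqr; exact: measurable_funD.
- by apply: emeasurable_funD; exact: measurable_funeM.
- move=> x _; rewrite -!EFinM -EFinD lee_fin -subr_ge0.
  rewrite [leRHS](_ : _ = t * (f x - t^-1 * g x) ^+ 2)%R.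
    by rewrite mulr_ge0 ?sqr_ge0// ltW.
  by field; rewrite gt_eqF.
Qed.

Section centered_indicator.
Variable B : set T.
Hypothesis mB : measurable B.
Let b : R := fine (pi B).
Let bE : pi B = b%:E. Proof. by rewrite fineK// fin_num_measure. Qed.

Definition centered_indic (x : T) : R := \1_B x - b.

Let g := centered_indic.

Lemma measurable_centered_indic : measurable_fun setT g.
Proof. by apply: measurable_funB => //; exact: measurable_indic. Qed.

Lemma square_integrable_centered_indic : square_integrable pi g.
Proof.
apply: (@square_integrable_bounded _ _ _ _ _ (1 + `|b|)%R).
  exact: measurable_centered_indic.
move=> x; apply: le_trans (ler_normB _ _) _; rewrite lerD2r indicE.
by case: (_ \in _); rewrite ?normr0 ?normr1.
Qed.

Let indic_int : \int[pi]_x (\1_B x)%:E = b%:E.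
Proof. by rewrite integral_indic// setIT. Qed.

Let indic_integrable : pi.-integrable setT (EFin \o \1_B).
Proof. by apply: integrable_indic => //;
  rewrite -ge0_fin_numE// fin_num_measure. Qed.

Lemma integral_centered_indic : \int[pi]_x (g x)%:E = 0.
Proof.
under eq_integral do rewrite EFinB.
rewrite integralB//; last exact: finite_measure_integrable_cst.
by rewrite indic_int probability_integral_cst subee.
Qed.

(** The variance of the indicator is the normalization in [iso_ratio]. *)
Lemma sqnorm_centered_indic : sqnorm pi g = pi B * pi (~` B).
Proof.
rewrite probability_setC// bE -EFinB -EFinM.
transitivity (\int[pi]_x ((1 - 2 * b)%:E * (\1_B x)%:E + (b ^+ 2)%:E)).
  apply: eq_integral => x _; rewrite -EFinM -EFinD; congr EFin.
  by rewrite /g /centered_indic indicE; case: (_ \in _); rewrite /=; ring.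
rewrite integralD//; last 2 first.
- exact: integrableZl.
- exact: finite_measure_integrable_cst.
rewrite integralZl// indic_int probability_integral_cst -EFinM -EFinD.
by congr EFin; ring.
Qed.

Let pB x : p x B = (fine (p x B))%:E.
Proof. by rewrite fineK// kernel_fin_num. Qed.

Lemma markov_op_centered_indic x : markov_op p g x = (fine (p x B) - b)%R.
Proof.
have ind_int : (p x).-integrable setT (EFin \o \1_B).
  exact: (@integrable_indic _ _ _ (kernel_prob p x)).
have cst_int : (p x).-integrable setT (EFin \o cst b).
  exact: (@finite_measure_integrable_cst _ _ _ (kernel_prob p x)).
rewrite /markov_op RintegralB//; congr (_ - _)%R.
  by rewrite /Rintegral integral_indic// setIT.
by rewrite /Rintegral (probability_integral_cst (kernel_prob p x)).
Qed.

Hypothesis pi_inv : invariant_prob p pi.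

(* [g - P g] is [p(x,B^c)] on [B] and [-p(x,B)] on [B^c], and both flows agree by
   invariance. *)
Lemma sqnorm_centered_indic_step :
  sqnorm pi (fun x => g x - markov_op p g x)%R <=
  2%:E * \int[pi]_(x in B) p x (~` B).
Proof.
have mBC : measurable (~` B) by exact: measurableC.
have mp := measurable_kernel p B mB; have mpC := measurable_kernel p _ mBC.
set F := \int[pi]_(x in B) p x (~` B).
have FF : \int[pi]_(x in B) p x B + F = pi B.
  rewrite /F -ge0_integralD//; [|exact: measurable_funTS..].
  transitivity (\int[pi]_(x in B) cst 1 x);
    last by rewrite integral_cst// mul1e.
  apply: eq_integral => x _; rewrite kernel_setC// addeC subeK//.
  exact: kernel_fin_num.
have FC : \int[pi]_(x in B) p x B + \int[pi]_(x in ~` B) p x B = pi B.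
  rewrite -ge0_integral_setU//; last first.
  - by rewrite disj_set2E setICr.
  - exact: measurable_funTS.
  by rewrite setUv pi_inv.
have FE : \int[pi]_(x in ~` B) p x B = F.
  have Bfin : \int[pi]_(x in B) p x B \is a fin_num.
    rewrite ge0_fin_numE ?integral_ge0//.
    apply: (@le_lt_trans _ _ (pi B)); last by rewrite ltey_eq fin_num_measure.
    by rewrite -FC leeDl// integral_ge0.
  by rewrite -[LHS](addeK _ Bfin) -[RHS](addeK _ Bfin) [X in X - _]addeC FC
    -FF [X in X - _]addeC.
have -> : 2%:E * F = \int[pi]_(x in B) p x (~` B) + \int[pi]_(x in ~` B) p x B.
  by rewrite FE -mule2n mule_natl.
rewrite (integral_mkcond B) (integral_mkcond (~` B)) -ge0_integralD//;
  last 4 first.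
- by move=> x _; rewrite patchE; case: ifPn.
- by apply/(measurable_restrictT _ mB); exact: measurable_funTS.
- by move=> x _; rewrite patchE; case: ifPn.
- by apply/(measurable_restrictT _ mBC); exact: measurable_funTS.
have mg := measurable_centered_indic.
apply: ge0_le_integral => //.
- by move=> x _; rewrite lee_fin sqr_ge0.
- by apply: measurable_sqr; apply: measurable_funB => //;
  exact: measurable_markov_op.
- apply: emeasurable_funD.
    by apply/(measurable_restrictT _ mB); exact: measurable_funTS.
  by apply/(measurable_restrictT _ mBC); exact: measurable_funTS.
- move=> x _; rewrite markov_op_centered_indic /g /centered_indic !patchE.
  have p1 : (fine (p x B) <= 1)%R by rewrite -lee_fin -pB kernel_le1.
  have p0 : (0 <= fine (p x B))%R by rewrite fine_ge0.
  rewrite in_setC indicE kernel_setC// pB; case: (_ \in _) => /=.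
    rewrite adde0 -EFinB lee_fin opprB addrA subrK expr2.
    by rewrite ler_piMl ?subr_ge0// lerBlDl lerDr.
  rewrite add0e lee_fin opprB addrA subrK sub0r sqrrN expr2.
  by rewrite ler_piMl.
Qed.

(** Telescoping: each increment has squared norm at most [D] by contraction. The weight
    [t = 1/(n+1)] reproduces the exact square, [(1 + 1/(n+1)) (n+1)^2 + (n+2) = (n+2)^2]; being
    undefined at 0, it forces the induction to start at 1. *)
Lemma sqnorm_centered_indic_iter n :
  sqnorm pi (fun x => g x - iter n (markov_op p) g x)%R <=
  (n%:R ^+ 2)%:E * (2%:E * \int[pi]_(x in B) p x (~` B)).
Proof.
set D := _ * \int[pi]_(x in B) _.
have g2 := square_integrable_centered_indic.
have mg := measurable_centered_indic.
have mi k := measurable_iter_markov_op p k mg.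
have gi k : square_integrable pi (iter k (markov_op p) g).
  exact: square_integrable_iter.
have D0 : 0 <= D by rewrite mule_ge0 ?lee_fin// integral_ge0.
have step k : sqnorm pi (fun x => iter k (markov_op p) g x -
    iter k.+1 (markov_op p) g x)%R <= D.
  elim: k => [|k ih]; first exact: sqnorm_centered_indic_step.
  by apply: le_trans ih; exact: (sqnorm_markov_opB pi_inv (gi k) (gi k.+1)).
elim: n => [|[_|n ih]].
- rewrite expr0n/= mul0e /sqnorm integral0_eq// => x _.
  by rewrite subrr expr0n.
- by rewrite (expr1n R 2) mul1e; exact: (step 0%N).
have -> : (fun x => g x - iter n.+2 (markov_op p) g x)%R =
    (fun x => (g x - iter n.+1 (markov_op p) g x) +
    (iter n.+1 (markov_op p) g x - iter n.+2 (markov_op p) g x))%R.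
  by apply/funext => x; rewrite addrA subrK.
have n0 : (0 < n.+1%:R :> R)%R by rewrite ltr0n.
apply: le_trans (@sqnormD_le n.+1%:R^-1 _ _ _ _ _) _.
- by rewrite invr_gt0.
- by apply: measurable_funB => //; exact: mi.
- by apply: measurable_funB; exact: mi.
rewrite invrK.
apply: (@le_trans _ _ ((1 + n.+1%:R^-1)%:E * ((n.+1%:R ^+ 2)%:E * D) +
    (1 + n.+1%:R)%:E * D)).
  by apply: leeD; rewrite lee_wpmul2l// lee_fin addr_ge0// ?invr_ge0.
rewrite muleA -ge0_muleDl ?lee_fin//.
rewrite le_eqVlt; apply/orP; left; apply/eqP; congr (_ * _).
rewrite -EFinM -EFinD; congr EFin; rewrite -[n.+2%:R]natr1.
by field; rewrite gt_eqF.
Qed.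

End centered_indicator.

Lemma iso_const1_of_spectral_gap : invariant_prob p pi ->
  L2_spectral_gap p pi -> 0 < iso_const p pi 1.
Proof.
move=> pi_inv [l gapl l1].
have [n [n0 n1]] : exists n, (0 < n)%N /\ spectral_gap_seq p pi n < 1.
  have /gapl[N _ HN] := open_ereal_lt' l1.
  by exists N.+1; split => //; apply: HN => /=.
have [c /andP[c0 c1] nc] : exists2 c : R, (0 <= c < 1)%R &
    spectral_gap_seq p pi n <= c%:E.
  (* The value [-oo], a supremum over an empty set, is not excluded at this point; [c = 0] covers
     it. *)
  case: (spectral_gap_seq p pi n) n1 => [s|//|_]; last first.
    by exists 0%R; rewrite ?lexx ?ltr01 ?leNye.
  rewrite lte_fin => s1; exists (Num.max 0 s)%R.
    by rewrite le_max lexx/= gt_max ltr01.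
  by rewrite lee_fin le_max lexx orbT.
pose rho := (c ^+ (n * 2))%R.
have rho0 : (0 <= rho)%R by rewrite exprn_ge0.
have rho1 : (rho < 1)%R by rewrite exprn_ilt1// ?muln_gt0 ?n0//
  -lt0n muln_gt0 n0.
have H := sqnorm_iter_le pi_inv rho0 ((spectral_gap_seqP pi_inv n0 c0).1 nc).
(* Then [(1 + t) rho = (1 + t) (1 - 2 t) <= 1 - t], so [V <= (1 + t) rho V + N F] yields
   [t V <= N F], whence the constant [t / N]. *)
pose t := ((1 - rho) / 2)%R.
have t0 : (0 < t)%R by rewrite divr_gt0// subr_gt0.
pose N := ((1 + t^-1) * (n%:R ^+ 2 * 2))%R.
have N0 : (0 < N)%R.
  by rewrite mulr_gt0 ?addr_gt0 ?invr_gt0// mulr_gt0// exprn_gt0// ltr0n.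
apply: (@lt_le_trans _ _ (t / N)%:E); first by rewrite lte_fin divr_gt0.
apply: le_ereal_inf_tmp => _ [B [mB pB] <-].
have mBC : measurable (~` B) by exact: measurableC.
apply: flux_le_iso_ratio => //.
have -> : \int[pi]_(x in B) kernel_iter p 1 x (~` B) =
    \int[pi]_(x in B) p x (~` B).
  by apply: eq_integral => x _; rewrite kernel_iter1E.
have g2 := square_integrable_centered_indic mB.
have g0 := integral_centered_indic mB.
have mg := measurable_centered_indic mB.
have mi := measurable_iter_markov_op p n mg.
have iterg := H _ g2 g0.
have stepg := sqnorm_centered_indic_iter mB pi_inv n.
have := @sqnormD_le t _ _ t0 mi (measurable_funB mg mi).
have -> : (fun x => iter n (markov_op p) (centered_indic B) x +
    (centered_indic B \- iter n (markov_op p) (centered_indic B)) x)%R =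
    centered_indic B.
  by apply/funext => x /=; rewrite addrC subrK.
have tV0 : (0 <= 1 + t^-1)%R by rewrite addr_ge0// invr_ge0 ltW.
move=> /le_trans /(_ (leeD (lee_wpmul2l _ iterg) (lee_wpmul2l _ stepg))).
rewrite !lee_fin tV0 (addr_ge0 ler01 (ltW t0)) => /(_ isT isT).
rewrite sqnorm_centered_indic//.
have Vfin : pi B * pi (~` B) \is a fin_num
  by rewrite fin_numM// fin_num_measure.
have Ffin : \int[pi]_(x in B) p x (~` B) \is a fin_num.
  rewrite ge0_fin_numE ?integral_ge0//.
  apply: (@le_lt_trans _ _ (pi B)); last by rewrite ltey_eq fin_num_measure.
  have -> : \int[pi]_(x in B) p x (~` B) =
      \int[pi]_(x in B) kernel_iter p 1 x (~` B).
    by apply: eq_integral => x _; rewrite kernel_iter1E.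
  exact: flux_le.
have : 0 <= pi B * pi (~` B) by rewrite mule_ge0.
rewrite -(fineK Vfin) -(fineK Ffin).
move: (fine _) (fine _) => F V.
rewrite -?(EFinM,EFinD) !lee_fin => V0 HV.
rewrite mulrAC ler_pdivrMr//.
have {}HV : (V <= (1 + t) * (rho * V) + N * F)%R by rewrite /N; lra.
have rhoE : (rho = 1 - 2 * t)%R by rewrite /t; field.
have : (0 <= t * t * V)%R by rewrite mulr_ge0// mulr_ge0 ?ltW.
by move: HV; rewrite rhoE; lra.
Qed.

Lemma L2_01_nonempty (B : set T) : measurable B -> 0 < pi B < 1 ->
  L2_01 pi !=set0.
Proof.
move=> mB /andP[B0 B1].
have mBC : measurable (~` B) by exact: measurableC.
have g2 := square_integrable_centered_indic mB.
have g0 := integral_centered_indic mB.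
have gfin := sqnorm_fin g2.
pose s := fine (sqnorm pi (centered_indic B)).
have s0 : (0 < s)%R.
  rewrite fine_gt0// ltey_eq gfin andbT sqnorm_centered_indic// mule_gt0//.
  by rewrite probability_setC// sube_gt0.
exists (fun x => (Num.sqrt s)^-1 * centered_indic B x)%R; apply/L2_01P; split.
- exact: square_integrableZ.
- under eq_integral do rewrite EFinM.
  by rewrite integralZl ?g0 ?mule0//; exact: square_integrable_integrable.
- rewrite sqnormZ; last exact: measurable_centered_indic.
  by rewrite exprVn sqr_sqrtr ?(ltW s0)// -(fineK gfin) -EFinM mulVf// gt_eqF.
Qed.

End converse.

Theorem theorem3 (d : measure_display) (T : measurableType d) (R : realType)
    (p : R.-pker T ~> T) (pi : probability T R)
    (p_pos_rec : positive_recurrent p pi)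
    (pi_uniq : uniquely_invariant p pi)
    (Q_equiv : edge_measures_equivalent p pi)
    (p_vwr : very_weak_reversible1 p pi)
    (r : \bar R) (r_gt1 : 1 < r)
    (A : (set T)^nat) (mA : forall n, measurable (A n))
    (piA : forall n, 0 < pi (A n) <= (2^-1)%:E)
    (k2A : iso_ratio p pi 2 (A n) @[n --> \oo] --> iso_const p pi 2)
    (fA_bounded :
      ereal_sup (range (fun n => 'N[cond_prob pi (mA n)]_r[
        (fun x => (\1_(A n) x)%:E * escape_ratio p (A n) x)])) < +oo) :
  L2_spectral_gap p pi <-> 0 < iso_const p pi 1.
Proof.
have pi_inv : invariant_prob p pi := pi_uniq.1.
split=> [|k1]; first exact: iso_const1_of_spectral_gap.
have k2 := iso_const1_iso_const2 r_gt1 piA k2A fA_bounded k1.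
have [k k0 kspread] := iso_const2_spread pi_inv Q_equiv.1 p_vwr k2.
(* The maximum with 0 provides a square root without having to show [k <= 2]. *)
pose rho := Num.max 0%R (1 - k ^+ 2 / 4)%R.
have rho0 : (0 <= rho)%R by rewrite le_max lexx.
have rho1 : (rho < 1)%R.
  by rewrite gt_max ltr01/= ltrBlDr ltrDl divr_gt0// exprn_gt0.
(* A nontrivial set makes [L2_01] nonempty, so the suprema in the gap are nonnegative rather than
   [-oo]. *)
have nontrivial : 0 < pi (A 0%N) < 1.
  have /andP[A0 A2] := piA 0%N.
  by rewrite A0 (le_lt_trans A2)// lte_fin invf_lt1// ltr1n.
apply: (@L2_spectral_gap_of_contraction _ _ _ _ _ pi_inv (Num.sqrt rho)).
- by rewrite sqrtr_ge0/= -[ltRHS]sqrtr1 ltr_sqrt.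
- exact: L2_01_nonempty nontrivial.
- move=> f f2 f0; rewrite sqr_sqrtr//.
  apply: le_trans (sqnorm_markov_op_contraction pi_inv k0 kspread f2 f0) _.
  by rewrite lee_wpmul2r ?sqnorm_ge0// lee_fin le_max lexx orbT.
Qed.
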